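(* Let $(\Omega,\mathcal{F},\mu)$ be a complete $\sigma$-finite measure space with $\mu(\Omega)>0$, and let $\mathcal{A}$ be its associated measure algebra ($\mathcal{F}$ modulo $\mu$-null sets). Let $(X,Y,\langle\cdot,\cdot\rangle)$ be a dual pair of Banach spaces such that $|\langle x,y\rangle|\le\|x\|\,\|y\|$ for all $x\in X$, $y\in Y$, and such that the closed unit ball of $X$ is $\sigma(X,Y)$-closed and the closed unit ball of $Y$ is $\sigma(Y,X)$-closed. Then the conditional set $\mathbf{L^0(X)}$ is a conditional Banach space which is conditionally isometrically isomorphic to $(\mathbf{X_c},\|\cdot\|_{\mathbf c})$, the conditional completion of $X$ constructed with respect to $\mathcal{A}$.
   Context: Conditional sets. The measure algebra $\mathcal{A}$ is a complete Boolean algebra satisfying the countable chain condition; write $a=[A]$ for the class of $A\in\mathcal{F}$. A partition is a family $(a_i)$ in $\mathcal{A}$ with $a_i\wedge a_j=0$ for $i\ne j$ and $\vee a_i=1$ (entries may be $0$). A conditional set of a non-empty set $E$ and $\mathcal{A}$ is a collection $\mathbf{E}$ of objects $x|a$ ($x\in E$, $a\in\mathcal{A}$) such that (C1) $x|b=y|a$ implies $a=b$; (C2) $x|b=y|b$ and $a\le b$ imply $x|a=y|a$; (C3) for each partition $(a_i)$ and each family $(x_i)$ in $E$ there is a unique $x\in E$ with $x|a_i=x_i|a_i$ for all $i$; it is written $x=\sum x_i|a_i$ (concatenation). A function between sets inducing conditional sets is stable if it commutes with concatenations; conditional functions are those induced by stable functions. Products carry componentwise concatenation. Step functions. For a non-empty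 set $E$, $E_s$ is the set of families $(x_i,a_i)$ in $E\times\mathcal{A}$ with $(a_i)$ a partition, where $(x_i,a_i)$ and $(y_j,b_j)$ are identified if $\vee\{a_i:x_i=z\}=\vee\{b_j:y_j=z\}$ for all $z\in E$; two classes agree on $a$ if these identities hold after meeting both sides with $a$. $E_s$ induces a conditional set and its elements are written $\sum x_i|a_i$. Conditional real numbers. On $\mathbb{R}_s$: $\sum x_i|a_i\leqslant\sum y_j|b_j$ (resp. $<$) iff $x_i\le y_j$ (resp. $x_i<y_j$) whenever $a_i\wedge b_j>0$; sum, product and absolute value are taken pointwise on the common refinement. $\mathbb{N}_s\subseteq\mathbb{R}_s$ carries the inherited order. A conditional sequence in $\mathbf{E}$ is a stable function $\mathbb{N}_s\to E$, $n\mapsto x_n$. The conditional real numbers $\mathbf{R}$ are induced by the set $R$ of conditional Cauchy sequences in $\mathbb{R}_s$ (for every $r\in\mathbb{R}_s$, $r>0$, there is $n_0\in\mathbb{N}_s$ with $|x_m-x_n|<r$ for all $m,n\geqslant n_0$) modulo $|x_n-y_n|\to0$ (for every $r\in\mathbb{R}_s$, $r>0$, there is $n_0\in\mathbb{N}_s$ with $|x_n-y_n|<r$ for all $n\geqslant n_0$; agreement on $a$ is the same condition with the inequality required on $a$ only), with representative-wise operations. It is known that $\mathbf{R}$ is conditionally isometrically isomorphic (as conditionally ordered field) to $\mathbf{L^0}$, the conditional set induced by the space $L^0$ of real-valued measurable functions on $\Omega$ modulo a.e. equality, with $x|a=\{y\in L^0: x1_A=y1_A\text{ a.e. for some }A\in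 a\}$, a.e. pointwise operations and a.e. order; $R$ and $L^0$ are identified. Under this identification $\mathbb{N}_s$ is the set of classes of measurable $\mathbb{N}$-valued functions, $R_+=\{r\in L^0:r\ge0\text{ a.e.}\}$ and $R_{++}=\{r\in L^0:r>0\text{ a.e.}\}$. Conditional normed and Banach spaces. A conditional vector space is a conditional set $\mathbf{E}$ with stable addition $E\times E\to E$ and stable scalar multiplication $R\times E\to E$ satisfying the vector space axioms (i.e. $E$ is an $R$-module with stable operations). A conditional norm is a stable function $\|\cdot\|:E\to R_+$ with $\|x\|=0$ iff $x=0$, $\|rx\|=|r|\|x\|$ for $r\in R$, and $\|x+y\|\leqslant\|x\|+\|y\|$. A conditional Banach space is a conditional normed vector space in which every conditional Cauchy sequence (for each $r\in R_{++}$ there is $n_0\in\mathbb{N}_s$ with $\|x_m-x_n\|<r$ for $m,n\geqslant n_0$) has a conditional limit $x$ (for each $r\in R_{++}$ there is $n_0\in\mathbb{N}_s$ with $\|x_n-x\|<r$ for $n\geqslant n_0$). A conditional isometric isomorphism is a bijective stable $R$-linear map preserving conditional norms. Conditional completion. On $X_s$ use pointwise operations and the norm $\|\sum x_i|a_i\|_s=\sum\|x_i\||a_i\in\mathbb{R}_s$. $X_c$ is the set of conditional Cauchy sequences in $X_s$ modulo $\|x_n-y_n\|_s\to0$, with representative-wise operations and concatenation and norm $\|[(x_n)]\|_c=\lim_n\|x_n\|_s\in R_+$; it induces $\mathbf{X_c}$. The Bochner space. $L^0(X)$ is the set of strongly measurable functions $x:\Omega\to X$ (a.e. norm-limits of sequences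 of simple functions) modulo a.e. equality. It induces the conditional set $\mathbf{L^0(X)}$ of objects $x|a=\{y\in L^0(X): x1_A=y1_A\text{ a.e. for some }A\in a\}$; concatenations are $\sum x_n1_{A_n}$. Its operations are $(x+y)(\omega)=x(\omega)+y(\omega)$, $(\alpha x)(\omega)=\alpha(\omega)x(\omega)$ for $\alpha\in L^0$, and its conditional norm is $\|x\|_0(\omega)=\|x(\omega)\|$, a.e. *)

(* Defs.v *)
From HB Require Import structures.
From mathcomp Require Import all_boot all_order all_algebra.
From mathcomp Require Import all_classical all_reals all_analysis.
From mathcomp Require Import sesquilinear generic_quotient.

Set Implicit Arguments.
Unset Strict Implicit.
Unset Printing Implicit Defensive.

Import Order.TTheory GRing.Theory Num.Theory.
Import numFieldNormedType.Exports.

Local Open Scope classical_set_scope.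
Local Open Scope ring_scope.
Local Open Scope quotient_scope.

Lemma setYI_sub (U : Type) (A B C D : set U) :
  (A `&` B) `+` (C `&` D) `<=` (A `+` C) `|` (B `+` D).
Proof.
move=> t; rewrite /setY /=.
have := pselect (A t); have := pselect (B t).
have := pselect (C t); have := pselect (D t); tauto.
Qed.

Lemma setYU_sub (U : Type) (A B C D : set U) :
  (A `|` B) `+` (C `|` D) `<=` (A `+` C) `|` (B `+` D).
Proof. by move=> t; rewrite /setY /=; tauto. Qed.

Lemma setYC_sub (U : Type) (A C : set U) :
  (~` A) `+` (~` C) `<=` (A `+` C) `|` (A `+` C).
Proof.
move=> t; rewrite /setY /=.
have := pselect (A t); have := pselect (C t); tauto.
Qed.

Fact malg_display : Order.disp_t. Proof. exact: Order.Disp tt tt. Qed.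

Section measure_algebra.
Context d (T : measurableType d) (R : realType).
Variable mu : {measure set T -> \bar R}.

(* The measurable sets, as a type. *)
Definition measset : Type := set_type (@measurable d T).
HB.instance Definition _ := Choice.on measset.

Definition measset_val (A : measset) : set T := val A.
Coercion measset_val : measset >-> set.

Definition Measset (A : set T) (mA : measurable A) : measset :=
  exist _ A (mem_set mA).

Lemma meassetP (A : measset) : measurable (A : set T).
Proof. exact: set_mem (valP A). Qed.

Definition measset_equiv (A B : measset) : bool := `[< mu (A `+` B) = 0%E >].

Let mY (A B : measset) : measurable ((A : set T) `+` B).
Proof. by apply: measurableU; apply: measurableD; exact: meassetP. Qed.

Lemma measset_equivW (A B C D E F : measset) :
  (A : set T) `+` B `<=` (C `+` D) `|` (E `+` F) ->
  measset_equiv C D -> measset_equiv E F -> measset_equiv A B.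
Proof.
move=> sub /asboolP CD /asboolP EF; apply/asboolP/eqP.
rewrite -measure_le0 -[leRHS]adde0 -{1}CD -EF.
apply: le_trans (measureU2 _ (mY C D) (mY E F)).
apply: le_measure => //; rewrite inE; first exact: mY.
by apply: measurableU; exact: mY.
Qed.

Let measset_equiv_refl : reflexive measset_equiv.
Proof. by move=> A; apply/asboolP; rewrite setYK measure0. Qed.

Let measset_equiv_sym : symmetric measset_equiv.
Proof. by move=> A B; rewrite /measset_equiv setYC. Qed.

Let measset_equiv_trans : transitive measset_equiv.
Proof.
move=> B A C; apply: measset_equivW => t [] [tA tB].
- by have [tb|tb] := pselect ((B : set T) t); [right; left|left; left].
- by have [tb|tb] := pselect ((B : set T) t); [left; right|right; right].
Qed.

Canonical measset_equiv_canonical :=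
  EquivRel measset_equiv
    measset_equiv_refl measset_equiv_sym measset_equiv_trans.

Definition malg : Type := {eq_quot measset_equiv}.
HB.instance Definition _ := Choice.on malg.
HB.instance Definition _ := EqQuotient.on malg.

Definition malg_class (A : measset) : malg := \pi_malg A.

Definition meassetI (A B : measset) : measset :=
  Measset (measurableI _ _ (meassetP A) (meassetP B)).
Definition meassetU (A B : measset) : measset :=
  Measset (measurableU _ _ (meassetP A) (meassetP B)).
Definition meassetC (A : measset) : measset :=
  Measset (measurableC (meassetP A)).

Definition malg_meet (a b : malg) : malg :=
  \pi_malg (meassetI (repr a) (repr b)).
Definition malg_join (a b : malg) : malg :=
  \pi_malg (meassetU (repr a) (repr b)).
Definition malg_compl (a : malg) : malg := \pi_malg (meassetC (repr a)).
Definition malg_bottom : malg := \pi_malg (Measset measurable0).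
Definition malg_top : malg := \pi_malg (Measset measurableT).

Let repr_equiv (A : measset) : measset_equiv (repr (\pi_malg A)) A.
Proof. by rewrite -eqmodE; apply/eqP; rewrite reprK. Qed.

Lemma malg_meetE (A B : measset) :
  malg_meet (\pi_malg A) (\pi_malg B) = \pi_malg (meassetI A B).
Proof.
apply/eqP; rewrite eqmodE; apply: measset_equivW (repr_equiv A) (repr_equiv B).
exact: setYI_sub.
Qed.

Lemma malg_joinE (A B : measset) :
  malg_join (\pi_malg A) (\pi_malg B) = \pi_malg (meassetU A B).
Proof.
apply/eqP; rewrite eqmodE; apply: measset_equivW (repr_equiv A) (repr_equiv B).
exact: setYU_sub.
Qed.

Lemma malg_complE (A : measset) :
  malg_compl (\pi_malg A) = \pi_malg (meassetC A).
Proof.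
apply/eqP; rewrite eqmodE; apply: measset_equivW (repr_equiv A) (repr_equiv A).
exact: setYC_sub.
Qed.

Let meassetP_eq (A B : measset) : (A : set T) = B -> \pi_malg A = \pi_malg B.
Proof. by move=> AB; congr (\pi _); exact: val_inj. Qed.

Let meetC : commutative malg_meet.
Proof.
elim/quotW=> A; elim/quotW=> B; rewrite !malg_meetE.
by apply: meassetP_eq; exact: (setIC (A : set T) B).
Qed.
Let joinC : commutative malg_join.
Proof.
elim/quotW=> A; elim/quotW=> B; rewrite !malg_joinE.
by apply: meassetP_eq; exact: (setUC (A : set T) B).
Qed.
Let meetA : associative malg_meet.
Proof.
elim/quotW=> A; elim/quotW=> B; elim/quotW=> C.
rewrite (malg_meetE B C) (malg_meetE A B) !malg_meetE; apply: meassetP_eq.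
exact: (setIA (A : set T) B C).
Qed.
Let joinA : associative malg_join.
Proof.
elim/quotW=> A; elim/quotW=> B; elim/quotW=> C.
rewrite (malg_joinE B C) (malg_joinE A B) !malg_joinE; apply: meassetP_eq.
exact: (setUA (A : set T) B C).
Qed.
Let joinKI b a : malg_meet a (malg_join a b) = a.
Proof.
elim/quotW: a => A; elim/quotW: b => B.
rewrite (malg_joinE A B) malg_meetE; apply: meassetP_eq.
by rewrite [LHS]setIC; exact: (setUK (A : set T) B).
Qed.
Let meetKU b a : malg_join a (malg_meet a b) = a.
Proof.
elim/quotW: a => A; elim/quotW: b => B.
rewrite (malg_meetE A B) malg_joinE; apply: meassetP_eq.
by rewrite [LHS]setUC; exact: (setIK (A : set T) B).
Qed.
Let meetUl : left_distributive malg_meet malg_join.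
Proof.
elim/quotW=> A; elim/quotW=> B; elim/quotW=> C.
rewrite (malg_joinE A B) (malg_meetE A C) (malg_meetE B C).
rewrite malg_meetE malg_joinE.
by apply: meassetP_eq; exact: (setIUl (A : set T) B C).
Qed.
Let meetxx : idempotent_op malg_meet.
Proof.
elim/quotW=> A; rewrite malg_meetE; apply: meassetP_eq.
exact: (setIid (A : set T)).
Qed.

HB.instance Definition _ := Order.isMeetJoinDistrLattice.Build malg_display malg
  (fun _ _ => erefl) (fun _ _ => erefl)
  meetC joinC meetA joinA joinKI meetKU meetUl meetxx.

Let le0m a : (malg_bottom <= a)%O.
Proof.
elim/quotW: a => A; apply/eqP.
change (malg_meet malg_bottom (\pi_malg A) = malg_bottom).
by rewrite malg_meetE; apply: meassetP_eq; exact: (set0I (A : set T)).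
Qed.
Let lem1 a : (a <= malg_top)%O.
Proof.
elim/quotW: a => A; apply/eqP.
change (malg_meet (\pi_malg A) malg_top = \pi_malg A).
by rewrite malg_meetE; apply: meassetP_eq; exact: (setIT (A : set T)).
Qed.
HB.instance Definition _ := Order.hasBottom.Build malg_display malg le0m.
HB.instance Definition _ := Order.hasTop.Build malg_display malg lem1.

Let meetmC a : (a `&` malg_compl a = \bot :> malg)%O.
Proof.
elim/quotW: a => A.
change (malg_meet (\pi_malg A) (malg_compl (\pi_malg A)) = malg_bottom).
rewrite (malg_complE A) malg_meetE; apply: meassetP_eq.
exact: (setICr (A : set T)).
Qed.
Let joinmC a : (a `|` malg_compl a = \top :> malg)%O.
Proof.
elim/quotW: a => A.
change (malg_join (\pi_malg A) (malg_compl (\pi_malg A)) = malg_top).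
rewrite (malg_complE A) malg_joinE; apply: meassetP_eq.
exact: (setUv (A : set T)).
Qed.
HB.instance Definition _ :=
  Order.TBDistrLattice_hasComplement.Build malg_display malg joinmC meetmC.

End measure_algebra.

Section conditional_sets.
Context d (T : measurableType d) (R : realType).
Variable mu : {measure set T -> \bar R}.
Local Notation A := (malg mu).

Definition is_partition (I : Type) (a : I -> A) : Prop :=
  (forall i j, i <> j -> (a i `&` a j)%O = \bot%O) /\
  supremums (range a) \top%O.

(* [cond x a] is the object x|a. *)
Record condset := CondSet {
  cs_elt :> Type ;
  cs_obj : Type ;
  cond : cs_elt -> A -> cs_obj }.

Definition is_concat (E : condset) (I : Type) (a : I -> A) (x_ : I -> E)
    (x : E) : Prop :=
  forall i, cond x (a i) = cond (x_ i) (a i).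

Record is_condset (E : condset) : Prop := IsCondSet {
  condset_nonempty : inhabited E ;
  condset_C1 : forall (x y : E) a b, cond x b = cond y a -> a = b ;
  condset_C2 : forall (x y : E) a b,
    cond x b = cond y b -> (a <= b)%O -> cond x a = cond y a ;
  condset_C3 : forall (I : Type) (a : I -> A) (x_ : I -> E),
    is_partition a -> exists! x, is_concat a x_ x }.

Definition stable (E F : condset) (f : E -> F) : Prop :=
  forall (I : Type) (a : I -> A) (x_ : I -> E) (x : E),
    is_partition a -> is_concat a x_ x -> is_concat a (fun i => f (x_ i)) (f x).

Definition condset_prod (E F : condset) : condset :=
  @CondSet (E * F) (cs_obj E * cs_obj F)
    (fun p a => (cond p.1 a, cond p.2 a)).

(* The conditional set whose objects are x|a = {y : y agrees with x on a}.
   The object also records a: for a one-point E the class alone does not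
   determine a, so (C1) would fail. For L^0(X) with X <> 0 the class alone does
   determine a (L0X_agree_inj below). *)
Definition condset_of (E : Type) (agree : A -> E -> E -> Prop) : condset :=
  @CondSet E (A * set E) (fun x a => (a, [set y | agree a x y])).

End conditional_sets.

Section step_functions.
Context d (T : measurableType d) (R : realType).
Variable mu : {measure set T -> \bar R}.
Local Notation A := (malg mu).

(* The class of a family (x_i, a_i) is determined by, and identified with, the
   partition z |-> \/ {a_i : x_i = z} indexed by E. *)
Definition step (E : pointedType) : Type :=
  set_type [set f : E -> A | is_partition f].
HB.instance Definition _ (E : pointedType) := Choice.on (step E).

Definition step_at (E : pointedType) (f : step E) : E -> A := val f.
Coercion step_at : step >-> Funclass.

Lemma is_partition_cst (E : pointedType) (e : E) :
  is_partition (fun z : E => if z == e then \top else \bot : A)%O.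
Proof.
split=> [i j ij|].
  case: (eqVneq i e) => [ie|_]; last by rewrite meet0x.
  by case: (eqVneq j e) => [je|_]; rewrite ?meetx0//; case: ij; rewrite ie je.
split=> [a _|b]; first exact: lex1.
by apply; exists e => //; rewrite eqxx.
Qed.

(* e|1 *)
Definition step_cst (E : pointedType) (e : E) : step E :=
  SigSub (mem_set (is_partition_cst e : [set f : E -> A | is_partition f] _)).

(* \sum x_i|a_i, for a partition a. The suprema exist when mu is sigma-finite,
   so the default value is not used then. *)
Definition step_of (E : pointedType) (I : Type) (x : I -> E) (a : I -> A) :
    step E :=
  insubd (step_cst point)
    (fun z => supremum \bot%O [set a i | i in [set i | x i = z]]).

Definition step_map (E F : pointedType) (h : E -> F) (f : step E) : step F :=
  step_of h f.

Definition step_map2 (E F G : pointedType) (h : E -> F -> G) (f : step E)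
    (g : step F) : step G :=
  step_of (fun p => h p.1 p.2) (fun p : E * F => f p.1 `&` g p.2)%O.

Lemma supremum_eq (S : set A) (s : A) :
  S !=set0 -> supremums S s -> supremum \bot%O S = s.
Proof.
move=> /set0P S0 Ss; rewrite /supremum (negbTE S0).
apply: (is_subset1_supremums (A := S)) => //.
exact: xgetPex (ex_intro _ s Ss).
Qed.

Lemma step_of_point (E : pointedType) (I : Type) (x : I -> E) (a : I -> A) i0 :
  a i0 = \top%O -> (forall i, i <> i0 -> a i = \bot%O) ->
  step_of x a = step_cst (x i0).
Proof.
move=> ai0 ai; apply: val_inj; rewrite /step_of.
suff -> : (fun z => supremum \bot%O [set a i | i in [set i | x i = z]]) =
    val (step_cst (x i0)) by rewrite insubdK//; exact: valP.
apply/funext => z /=; case: eqVneq => [->|zi0].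
  apply: supremum_eq; first by exists (a i0), i0.
  split=> [b _|b]; first exact: lex1.
  by apply; exists i0.
have [->|/set0P S0] := eqVneq [set a i | i in [set i | x i = z]] set0.
  by rewrite supremum0.
apply: supremum_eq => //; split => [_ [i xi <-]|b _]; last exact: le0x.
by rewrite ai// => ii0; move: zi0; rewrite -xi ii0 eqxx.
Qed.

Lemma step_map_cst (E F : pointedType) (h : E -> F) (e : E) :
  step_map h (step_cst e) = step_cst (h e).
Proof.
apply: step_of_point => [|z ze]; rewrite /step_at /= ?eqxx//.
by case: eqVneq ze.
Qed.

Lemma step_map2_cst (E F G : pointedType) (h : E -> F -> G) (e : E) (f : F) :
  step_map2 h (step_cst e) (step_cst f) = step_cst (h e f).
Proof.
apply: (step_of_point (fun p => h p.1 p.2) (i0 := (e, f))) => [|[u v] uv].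
  by rewrite /step_at /= !eqxx meetxx.
rewrite /step_at /=; case: eqVneq => [ue|_]; last by rewrite meet0x.
by case: eqVneq => [ve|_]; rewrite ?meetx0//; case: uv; rewrite ue ve.
Qed.

(* The relation r holds between f and g on a; "everywhere" is a = \top. *)
Definition step_rel (E F : pointedType) (r : E -> F -> Prop) (a : A)
    (f : step E) (g : step F) : Prop :=
  forall x y, (\bot < f x `&` g y `&` a)%O -> r x y.

Definition step_agree (E : pointedType) (a : A) (f g : step E) : Prop :=
  forall z, (f z `&` a = g z `&` a)%O.

Definition condstep (E : pointedType) : condset mu :=
  condset_of (@step_agree E).

Definition condnat : condset mu := condstep nat.
Definition condnat_le (m n : condnat) : Prop := step_rel leq \top%O m n.

(* r < s on a, and r > 0, in R_s *)
Definition step_lt_on (a : A) (r s : step R) : Prop :=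
  step_rel (fun x y : R => x < y) a r s.
Definition step_pos (r : step R) : Prop :=
  step_lt_on \top%O (step_cst (0 : R)) r.

End step_functions.

Section conditional_scalars.
Context d (T : measurableType d) (R : realType).
Variable mu : {measure set T -> \bar R}.
Local Notation A := (malg mu).

Definition L0 : Type := {mfun_ mu, T >-> measurableTypeR R}.
HB.instance Definition _ := Choice.on L0.
HB.instance Definition _ := EqQuotient.on L0.

(* The a.e. class of f; 0 if f is not measurable. *)
Definition L0_of (f : T -> R) : L0 :=
  \pi_L0 (insubd (cst 0 : {mfun T >-> measurableTypeR R}) f).

Definition L0_fun (f : L0) : T -> R := repr f.
Coercion L0_fun : L0 >-> Funclass.

(* The representatives chosen by the coercion to functions are immaterial: each
   definition below is invariant under a.e. equality. *)
Definition L0_le (f g : L0) : Prop := {ae mu, forall w, f w <= g w}.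
Definition L0_lt (f g : L0) : Prop := {ae mu, forall w, f w < g w}.
Definition L0_add (f g : L0) : L0 := L0_of (fun w => f w + g w).
Definition L0_sub (f g : L0) : L0 := L0_of (fun w => f w - g w).
Definition L0_mul (f g : L0) : L0 := L0_of (fun w => f w * g w).
Definition L0_abs (f : L0) : L0 := L0_of (fun w => `|f w|).
Definition L0_0 : L0 := L0_of (fun=> 0).
Definition L0_1 : L0 := L0_of (fun=> 1).

Definition L0_agree (a : A) (f g : L0) : Prop :=
  exists2 B : measset T, malg_class mu B = a & ae_eq mu (B : set T) f g.

Definition condL0 : condset mu := condset_of L0_agree.

(* The embedding \sum r_i|a_i |-> \sum r_i 1_{A_i} of the step functions. *)
Definition L0_of_step (f : step mu R) : L0 :=
  xget L0_0 [set g : L0 | is_concat f (fun v : R => L0_of (cst v) : condL0) g].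

(* The conditional limit in L^0 of a sequence of R_s, embedded in L^0. *)
Definition L0_lim (r : condnat mu -> step mu R) : L0 :=
  xget L0_0 [set g : L0 | forall e : L0, L0_lt L0_0 e ->
    exists n0 : condnat mu, forall n, condnat_le n0 n ->
      L0_lt (L0_abs (L0_sub (L0_of_step (r n)) g)) e].

End conditional_scalars.

Section conditional_banach.
Context d (T : measurableType d) (R : realType).
Variable mu : {measure set T -> \bar R}.
Local Notation L0 := (L0 mu).
Local Notation condnat := (condnat mu).

Record cnormed := CNormed {
  cn_set :> condset mu ;
  cn_zero : cn_set ;
  cn_opp : cn_set -> cn_set ;
  cn_add : cn_set -> cn_set -> cn_set ;
  cn_scale : L0 -> cn_set -> cn_set ;
  cn_norm : cn_set -> L0 }.

Definition cn_dist (E : cnormed) (x y : E) : L0 :=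
  cn_norm (cn_add x (cn_opp y)).

Record is_cond_vector_space (E : cnormed) : Prop := IsCondVectorSpace {
  cv_condset : is_condset E ;
  cv_addA : associative (@cn_add E) ;
  cv_addC : commutative (@cn_add E) ;
  cv_add0 : left_id (cn_zero E) (@cn_add E) ;
  cv_addN : left_inverse (cn_zero E) (@cn_opp E) (@cn_add E) ;
  cv_scaleA : forall (r s : L0) (x : E),
    cn_scale r (cn_scale s x) = cn_scale (L0_mul r s) x ;
  cv_scale1 : forall x : E, cn_scale (L0_1 mu) x = x ;
  cv_scaleDr : forall (r : L0) (x y : E),
    cn_scale r (cn_add x y) = cn_add (cn_scale r x) (cn_scale r y) ;
  cv_scaleDl : forall (r s : L0) (x : E),
    cn_scale (L0_add r s) x = cn_add (cn_scale r x) (cn_scale s x) ;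
  cv_stable_add :
    stable (fun p : condset_prod E E => cn_add p.1 p.2 : E) ;
  cv_stable_scale :
    stable (fun p : condset_prod (condL0 mu) E => cn_scale p.1 p.2 : E) }.

Record is_cond_norm (E : cnormed) : Prop := IsCondNorm {
  cn_stable : stable (fun x : E => cn_norm x : condL0 mu) ;
  cn_ge0 : forall x : E, L0_le (L0_0 mu) (cn_norm x) ;
  cn_eq0 : forall x : E, cn_norm x = L0_0 mu <-> x = cn_zero E ;
  cn_normZ : forall (r : L0) (x : E),
    cn_norm (cn_scale r x) = L0_mul (L0_abs r) (cn_norm x) ;
  cn_triangle : forall x y : E,
    L0_le (cn_norm (cn_add x y)) (L0_add (cn_norm x) (cn_norm y)) }.

Definition cond_cauchy (E : cnormed) (x : condnat -> E) : Prop :=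
  forall r : L0, L0_lt (L0_0 mu) r ->
  exists n0 : condnat, forall m n, condnat_le n0 m -> condnat_le n0 n ->
    L0_lt (cn_dist (x m) (x n)) r.

Definition cond_limit (E : cnormed) (x : condnat -> E) (l : E) : Prop :=
  forall r : L0, L0_lt (L0_0 mu) r ->
  exists n0 : condnat, forall n, condnat_le n0 n -> L0_lt (cn_dist (x n) l) r.

Record is_cond_banach (E : cnormed) : Prop := IsCondBanach {
  cb_vector_space : is_cond_vector_space E ;
  cb_norm : is_cond_norm E ;
  cb_complete : forall x : condnat -> E,
    stable x -> cond_cauchy x -> exists l, cond_limit x l }.

Record is_cond_isometric_iso (E F : cnormed) (phi : E -> F) : Prop :=
  IsCondIsometricIso {
  ci_bij : bijective phi ;
  ci_stable : stable phi ;
  ci_add : forall x y : E, phi (cn_add x y) = cn_add (phi x) (phi y) ;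
  ci_scale : forall (r : L0) (x : E), phi (cn_scale r x) = cn_scale r (phi x) ;
  ci_norm : forall x : E, cn_norm (phi x) = cn_norm x }.

Definition cond_isometrically_isomorphic (E F : cnormed) : Prop :=
  exists phi : E -> F, is_cond_isometric_iso phi.

End conditional_banach.

Section bochner.
Context d (T : measurableType d) (R : realType).
Variables (mu : {measure set T -> \bar R}) (X : normedModType R).

(* No integrability is required of simple functions; when mu is sigma-finite,
   restricting to finite-measure support gives the same strongly measurable
   functions. *)
Definition simple_fun (s : T -> X) : Prop :=
  finite_set (range s) /\ forall v, measurable (s @^-1` [set v]).

Definition strongly_measurable (x : T -> X) : Prop :=
  exists2 s : nat -> T -> X, (forall n, simple_fun (s n)) &
    {ae mu, forall w, s ^~ w @ \oo --> x w}.

Lemma strongly_measurable_cst (v : X) : strongly_measurable (cst v).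
Proof.
exists (fun=> cst v) => [_|]; last by apply/aeW => w; exact: cvg_cst.
split; first by apply: sub_finite_set (finite_set1 v) => _ [w _ <-].
by move=> u; rewrite preimage_cst; case: ifP.
Qed.

Definition smfun : Type := set_type [set x : T -> X | strongly_measurable x].
HB.instance Definition _ := Choice.on smfun.

Definition smfun_fun (x : smfun) : T -> X := val x.
Coercion smfun_fun : smfun >-> Funclass.

Definition smfun_cst (v : X) : smfun :=
  SigSub (mem_set (strongly_measurable_cst v :
    [set x : T -> X | strongly_measurable x] _)).

Definition smfun_equiv (x y : smfun) : bool := `[< x = y %[ae mu] >].

Let smfun_equiv_refl : reflexive smfun_equiv.
Proof. by move=> x; apply/asboolP; exact: ae_eq_refl. Qed.
Let smfun_equiv_sym : symmetric smfun_equiv.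
Proof. by move=> x y; apply/idP/idP => /asboolP h; apply/asboolP/ae_eq_sym. Qed.
Let smfun_equiv_trans : transitive smfun_equiv.
Proof.
by move=> y x z /asboolP xy /asboolP yz; apply/asboolP/(ae_eq_trans xy yz).
Qed.
Canonical smfun_equiv_canonical :=
  EquivRel smfun_equiv smfun_equiv_refl smfun_equiv_sym smfun_equiv_trans.

Definition L0X : Type := {eq_quot smfun_equiv}.
HB.instance Definition _ := Choice.on L0X.
HB.instance Definition _ := EqQuotient.on L0X.

(* The a.e. class of x; 0 if x is not strongly measurable. *)
Definition L0X_of (x : T -> X) : L0X := \pi_L0X (insubd (smfun_cst 0) x).

Definition L0X_fun (x : L0X) : T -> X := repr x.
Coercion L0X_fun : L0X >-> Funclass.

Definition L0X_agree (a : malg mu) (x y : L0X) : Prop :=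
  exists2 B : measset T, malg_class mu B = a & ae_eq mu (B : set T) x y.

Lemma L0X_ofE (x : T -> X) : strongly_measurable x ->
  L0X_of x = x %[ae mu].
Proof.
move=> mx; have mx' : x \in [set x : T -> X | strongly_measurable x].
  exact: mem_set.
pose y : smfun := insubd (smfun_cst 0) x.
have yE : (y : T -> X) = x by rewrite /y /smfun_fun insubdK.
have /asboolP h : smfun_equiv (repr (\pi_L0X y)) y.
  by rewrite -eqmodE; apply/eqP; rewrite reprK.
by apply: filterS h => w; rewrite yE.
Qed.

Lemma strongly_measurable_shift (B : set T) (x : T -> X) (v : X) :
  measurable B -> strongly_measurable x ->
  strongly_measurable (fun w => if w \in B then x w else x w + v).
Proof.
move=> mB [s ss sx].
exists (fun n w => if w \in B then s n w else s n w + v) => [n|].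
  have [fs ms] := ss n; split.
    apply: (@sub_finite_set _ _ (range (s n) `|` (+%R^~ v) @` range (s n))).
      move=> _ [w _ <-]; case: ifP => _; first by left; exists w.
      by right; exists (s n w) => //; exists w.
    by rewrite finite_setU; split=> //; exact: finite_image.
  move=> u; rewrite [X in measurable X](_ : _ =
      (B `&` s n @^-1` [set u]) `|` (~` B `&` s n @^-1` [set (u - v)])).
    by apply: measurableU; apply: measurableI => //; exact: measurableC.
  apply/seteqP; split=> w /=.
    case: ifPn => [/set_mem Bw <-|/negP Bw <-]; first by left.
    by right; rewrite addrK; split=> // wB; apply: Bw; exact: mem_set.
  move=> [[Bw <-]|[Bw ->]]; first by rewrite mem_set.
  by rewrite memNset// subrK.
apply: filterS sx => w sx.
by case: ifP => _ //; apply: cvgD => //; exact: cvg_cst.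
Qed.

(* If X is not 0, the class {y : y agrees with x on a} alone determines a. *)
Lemma L0X_agree_inj (v : X) (x y : L0X) (a b : malg mu) : v != 0 ->
  [set z | L0X_agree b x z] = [set z | L0X_agree a y z] -> a = b.
Proof.
move=> v0.
suff sub (x' y' : L0X) (a' b' : malg mu) :
    [set z | L0X_agree b' x' z] = [set z | L0X_agree a' y' z] -> (a' <= b')%O.
  by move=> e; apply/eqP; rewrite eq_le (sub _ _ _ _ e) (sub _ _ _ _ (esym e)).
move=> e; pose B := repr b'.
have bB : malg_class mu B = b' by rewrite /malg_class reprK.
have xs : strongly_measurable x' by exact: set_mem (valP (repr x')).
have zs := strongly_measurable_shift v (meassetP B) xs.
have /L0X_ofE zE := zs; set z := L0X_of _ in zE.
have [A1 A1a y1] : L0X_agree a' y' x'.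
  rewrite -/([set z | L0X_agree a' y' z] x') -e; exists B => //.
  by apply: aeW.
have [A2 A2a y2] : L0X_agree a' y' z.
  rewrite -/([set z | L0X_agree a' y' z] z) -e; exists B => //.
  by apply: filterS zE => w + Bw => /(_ I) ->; rewrite mem_set.
have meetE (C D : measset T) :
    (malg_class mu C `&` malg_class mu D)%O = malg_class mu (meassetI C D).
  exact: malg_meetE.
have -> : a' = malg_class mu (meassetI A1 A2) by rewrite -meetE A1a A2a meetxx.
rewrite -bB leEmeet meetE; apply/eqP.
apply/eqP; rewrite eqmodE; apply/asboolP.
apply: measure_negligible.
  by apply: measurableU; apply: measurableD; exact: meassetP.
have : {ae mu, forall w, (A1 : set T) w -> (A2 : set T) w -> (B : set T) w}.
  apply: filterS3 y1 y2 zE => w y1 y2 zE wA1 wA2; apply: contrapT => wB.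
  have := zE I; rewrite memNset// -(y2 wA2) (y1 wA1) => /eqP.
  by rewrite -{1}[x' w]addr0 (inj_eq (addrI _)) eq_sym (negbTE v0).
apply: negligibleS => w wAB sub.
case: wAB => -[] wA nw; first by apply: nw; case: wA.
by case: (wA) => wA1 wA2; apply: nw; split=> //; exact: sub.
Qed.

Definition L0X_zero : L0X := L0X_of (fun=> 0).
Definition L0X_opp (x : L0X) : L0X := L0X_of (fun w => - x w).
Definition L0X_add (x y : L0X) : L0X := L0X_of (fun w => x w + y w).
Definition L0X_scale (r : L0 mu) (x : L0X) : L0X :=
  L0X_of (fun w => r w *: x w).
Definition L0X_norm (x : L0X) : L0 mu := L0_of mu (fun w => `|x w|).

Definition bochner : cnormed mu :=
  @CNormed _ _ _ mu (condset_of L0X_agree)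
    L0X_zero L0X_opp L0X_add L0X_scale L0X_norm.

End bochner.

Section completion.
Context d (T : measurableType d) (R : realType).
Variables (mu : {measure set T -> \bar R}).
Local Notation condnat := (condnat mu).

Section cauchy_classes.
Variable X : normedModType R.
Local Notation seqs := (condnat -> condstep mu X).

Definition step_dist (x y : step mu X) : step mu R :=
  step_map (fun v : X => `|v|) (step_map2 (fun u v : X => u - v) x y).

Definition step_cauchy (x : seqs) : Prop :=
  forall r : step mu R, step_pos r ->
  exists n0 : condnat, forall m n, condnat_le n0 m -> condnat_le n0 n ->
    step_lt_on \top%O (step_dist (x m) (x n)) r.

Definition cauchy_seqs : set seqs := [set x | stable x /\ step_cauchy x].

(* |x_n - y_n| -> 0 on a. *)
Definition seqs_agree (a : malg mu) (x y : seqs) : Prop :=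
  forall r : step mu R, step_pos r ->
  exists n0 : condnat, forall n, condnat_le n0 n ->
    step_lt_on a (step_dist (x n) (y n)) r.

Definition cauchy_class (x : seqs) : set seqs :=
  [set y | cauchy_seqs y /\ seqs_agree \top%O x y].

Lemma cauchy_seqs0 : cauchy_seqs (fun=> step_cst mu 0).
Proof.
split=> [I a x_ x _ _ i //|r r0]; exists (step_cst mu 0%N) => m n _ _.
by rewrite /step_dist step_map2_cst step_map_cst subrr normr0.
Qed.

Definition Xc : Type := set_type (cauchy_class @` cauchy_seqs).

Definition Xc_repr (c : Xc) : seqs := sval (cid2 (set_mem (valP c))).

Definition Xc_zero : Xc := SigSub (mem_set (imageP cauchy_class cauchy_seqs0)).

(* The class of x, for a conditional Cauchy sequence x. The quotient is taken as
   a set of equivalence classes because transitivity of the equivalence needs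
   sigma-finiteness of mu, which is a hypothesis only of the theorem. *)
Definition Xc_of (x : seqs) : Xc := insubd Xc_zero (cauchy_class x).

Definition Xc_agree (a : malg mu) (c c' : Xc) : Prop :=
  seqs_agree a (Xc_repr c) (Xc_repr c').

Definition Xc_opp (c : Xc) : Xc :=
  Xc_of (fun n => step_map (fun u : X => - u) (Xc_repr c n)).
Definition Xc_add (c c' : Xc) : Xc :=
  Xc_of (fun n =>
    step_map2 (fun u v : X => u + v) (Xc_repr c n) (Xc_repr c' n)).
Definition Xc_norm (c : Xc) : L0 mu :=
  L0_lim (fun n => step_map (fun u : X => `|u|) (Xc_repr c n)).

End cauchy_classes.

(* The conditional real numbers are the completion of R_s; [(r_n)] is identified
   with the limit in L^0 of the r_n. *)
Definition cond_real : Type := Xc R^o.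

Definition L0_of_real (c : cond_real) : L0 mu := L0_lim (Xc_repr c).

Definition real_of_L0 (r : L0 mu) : cond_real :=
  xget (Xc_zero R^o) [set c | L0_of_real c = r].

(* r acts through a representative (r_n) of the conditional real it is. *)
Definition Xc_scale (X : normedModType R) (r : L0 mu) (c : Xc X) : Xc X :=
  Xc_of (fun n => step_map2 (fun (t : R) (u : X) => t *: u)
    (Xc_repr (real_of_L0 r) n) (Xc_repr c n)).

Definition completion (X : normedModType R) : cnormed mu :=
  @CNormed _ _ _ mu (condset_of (@Xc_agree X))
    (Xc_zero X) (@Xc_opp X) (@Xc_add X) (@Xc_scale X) (@Xc_norm X).

End completion.

Section dual_pair.
Context (R : realType) (X Y : normedModType R).
Variable B : {bilinear X -> Y -> R | *%R & *%R}.

Definition separating : Prop :=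
  (forall x, (forall y, B x y = 0) -> x = 0) /\
  (forall y, (forall x, B x y = 0) -> y = 0).

(* sigma(X, Y) and sigma(Y, X) *)
Definition sigmaXY : Type :=
  initial_topology (fun x : X => (fun y => B x y) : {ptws Y -> R}).
Definition sigmaYX : Type :=
  initial_topology (fun y : Y => (fun x => B x y) : {ptws X -> R}).
HB.instance Definition _ := Topological.on sigmaXY.
HB.instance Definition _ := Topological.on sigmaYX.

End dual_pair.

(* Main.v *)
Require Import Defs.
From mathcomp Require Import all_boot all_order all_algebra.
From mathcomp Require Import all_classical all_reals all_analysis.
From mathcomp Require Import sesquilinear generic_quotient measurable_realfun.

(* Up to null sets everything becomes pointwise. Sigma-finiteness makes the
   partitions of the measure algebra countable, so a step function is (the a.e.
   class of) a countably valued measurable function, and a conditional natural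
   number a measurable N-valued function. A stable sequence (x_n) is determined
   by its values at the constants, x_n(w) = x_{n(w)}(w), and choosing thresholds
   n0(w) measurably shows that it is conditionally Cauchy, resp. convergent, iff
   k |-> x_k(w) is so for almost every w. Hence a class in X_c is determined by
   its a.e. pointwise limit, and these limits are exactly the strongly
   measurable functions. *)

Set Implicit Arguments.
Unset Strict Implicit.
Unset Printing Implicit Defensive.

Import Order.TTheory GRing.Theory Num.Theory.
Import numFieldNormedType.Exports.
Local Open Scope classical_set_scope.
Local Open Scope ring_scope.

(** * Countably valued measurable functions *)

Section countably_valued.
Context d (T : measurableType d).

(** The obstacle is the order of quantifiers: partitions are indexed by arbitrary types and radii
    range over all of $R_{++}$, while an almost-everywhere quantifier commutes only with countable
    ones. Three devices restore countability. A partition is replaced by an index function [h] with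
    countable range, and claims are proved on each fiber of [h]. Cauchy and convergence conditions
    are tested at the constant radii $1/(j+1)$ only, and recovered for variable radii by measurable
    selection. Strong measurability is rephrased with countably valued instead of finitely valued
    functions: this class is closed under the substitution [g (h w) w], which both gluing along a
    partition and evaluation at a conditional natural number require. Completeness of $\mu$ keeps
    functions measurable when they are altered on null sets. *)

Definition countably_valued (I : Type) (h : T -> I) : Prop :=
  countable (range h) /\ forall i, measurable (h @^-1` [set i]).

Lemma countable_bigcup_measurable (I : Type) (D : set I) (F : I -> set T) :
  countable D -> (forall i, D i -> measurable (F i)) ->
  measurable (\bigcup_(i in D) F i).
Proof.
move=> cD mF; rewrite bigcup_set_type; apply: countable_bigcupT_measurable.
  by rewrite (eq_countable (card_setT _)).
by move=> i; apply: mF; exact: set_valP.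
Qed.

(** On the fiber [h = i] the set coincides with [Q i], and only countably many fibers are
    non-empty. *)
Lemma diag_measurable (I : Type) (h : T -> I) (Q : I -> set T) :
  countably_valued h -> (forall i, measurable (Q i)) ->
  measurable [set w | Q (h w) w].
Proof.
move=> [ch mh] mQ.
rewrite [X in measurable X](_ : _ =
    \bigcup_(i in range h) (h @^-1` [set i] `&` Q i)).
  by apply: countable_bigcup_measurable => // i _; exact: measurableI.
by apply/seteqP; split=> [w Qw|w [_ _ [<-]]//]; exists (h w) => //; exists w.
Qed.

Lemma countably_valued_diag (I J : Type) (h : T -> I) (g : I -> T -> J) :
  countably_valued h -> (forall i, countably_valued (g i)) ->
  countably_valued (fun w => g (h w) w).
Proof.
move=> ch cg; split; last first.
  by move=> j; apply: (diag_measurable (Q := fun i => g i @^-1` [set j]) ch) =>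
    i; exact: (cg i).2.
have : range (fun w => g (h w) w) `<=` \bigcup_(i in range h) range (g i).
  move=> _ [w _ <-].
  by exists (h w); [exists w|exists w].
move=> /subset_card_le/sub_countable; apply.
by apply: bigcup_countable => [|i _]; [exact: ch.1|exact: (cg i).1].
Qed.

Lemma countably_valued_cst (I : Type) (i : I) : countably_valued (fun=> i : I).
Proof.
split; last by move=> j; rewrite preimage_cst; case: ifP.
by apply: finite_set_countable; apply: sub_finite_set (finite_set1 i) => _
  [w _ <-].
Qed.

Lemma countably_valued_comp (I J : Type) (F : I -> J) (h : T -> I) :
  countably_valued h -> countably_valued (fun w => F (h w)).
Proof.
move=> ch; apply: (countably_valued_diag (g := fun i _ => F i)) => // i.
exact: countably_valued_cst.
Qed.

Lemma countably_valued_comp2 (I J K : Type) (F : I -> J -> K) (h : T -> I)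
    (g : T -> J) :
  countably_valued h -> countably_valued g ->
  countably_valued (fun w => F (h w) (g w)).
Proof.
move=> ch cg; apply: (countably_valued_diag (g := fun i w => F i (g w))) =>
  // i.
exact: countably_valued_comp.
Qed.

End countably_valued.

Lemma ex_least (P : nat -> Prop) : (exists n, P n) ->
  exists n, P n /\ forall m, (m < n)%N -> ~ P m.
Proof.
move=> [n0 Pn0]; have e : exists n, `[< P n >] by exists n0; apply/asboolP.
exists (ex_minn e); case: ex_minnP => n /asboolP Pn min; split=> // m mn Pm.
by have := min _ (introT (asboolP _) Pm); rewrite leqNgt mn.
Qed.

(** * Countable exchange of quantifiers and measurable selection modulo null sets *)

Section almost_everywhere.
Context d (T : measurableType d) (R : realType).
Variable mu : {measure set T -> \bar R}.

Lemma ae_countable (I : Type) (D : set I) (P : I -> T -> Prop) :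
  countable D -> (forall i, D i -> \forall w \ae mu, P i w) ->
  \forall w \ae mu, forall i, D i -> P i w.
Proof.
move=> /countable_injP[f fI] DP.
(* [F k] is the exceptional set of the index numbered [k] by the injection [f], and is empty if no
   index has that number. *)
pose F k := [set w | exists2 i, D i & f i = k /\ ~ P i w].
have : mu.-negligible (\bigcup_k F k).
  apply: negligible_bigcup => k.
  have [[i [Di fi]]|no] := pselect (exists i, D i /\ f i = k).
    apply: negligibleS (DP i Di) => w [j Dj [fj nP]].
    by rewrite -(fI j i) ?inE// fj.
  apply: negligibleS (negligible_set0 mu) => w [j Dj [fj _]].
  by apply: no; exists j.
apply: negligibleS => w /= /existsNP[i] /not_implyP[Di nP].
by exists (f i) => //; exists i.
Qed.

(** The exceptional null set may depend on the value [i], although [I] may be uncountable: only the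
    countably many values that [h] takes contribute. *)
Lemma ae_fibers (I : Type) (h : T -> I) (P : T -> Prop) :
  countably_valued h -> (forall i, \forall w \ae mu, h w = i -> P w) ->
  \forall w \ae mu, P w.
Proof.
move=> [ch _] hP.
apply: filterS (ae_countable (P := fun i w => h w = i -> P w) ch _) => [w|i _].
  by move=> /(_ (h w)); apply => //; exists w.
exact: hP.
Qed.

Hypothesis mu_complete : measure_is_complete mu.

Lemma ae_measurable (A B : set T) :
  measurable A -> (\forall w \ae mu, A w <-> B w) -> measurable B.
Proof.
move=> mA; set N := ~` [set w | A w <-> B w].
rewrite /prop_near1 /nbhs /= /almost_everywhere -/N => N0.
have mN : measurable N by exact: mu_complete.
rewrite (_ : B = (A `\` N) `|` (B `&` N)).
  apply: measurableU; first exact: measurableD.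
  by apply: mu_complete; apply: negligibleS N0 => w [].
apply/seteqP; split=> w; rewrite /N /=.
  by move=> Bw; have [AB|AB] := pselect (A w <-> B w); tauto.
by have [AB|AB] := pselect (A w <-> B w); tauto.
Qed.

(** The least admissible index is selected. Where there is none, the value is the default 0; this
    happens on a null set only, so completeness keeps the fibers measurable. *)
Lemma ae_measurable_select (Q : nat -> set T) :
  (forall N, measurable (Q N)) -> (\forall w \ae mu, exists N, Q N w) ->
  exists2 h : T -> nat, countably_valued h & \forall w \ae mu, Q (h w) w.
Proof.
move=> mQ eQ.
pose S w := [set N | Q N w /\ forall M, (M < N)%N -> ~ Q M w].
have Sh w : (exists N, Q N w) -> S w (xget 0%N (S w)).
  by move=> /ex_least[N SN]; apply: (xgetPex 0%N); exists N.
exists (fun w => xget 0%N (S w)); last by apply: filterS eQ => w /Sh[].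
split=> [|N]; first exact: countableP.
apply: (@ae_measurable (Q N `&` \bigcap_(M < N) ~` Q M)).
  apply: measurableI => //; apply: bigcap_measurableType => M _.
  exact: measurableC.
apply: filterS eQ => w /Sh; set h := xget _ _ => -[Qh minh].
split=> /= [[QN minN]|<-//].
apply/eqP; rewrite eqn_leq leqNgt [X in _ && X]leqNgt.
by apply/andP; split; apply/negP => lt; [exact: minh lt _|exact: minN lt _].
Qed.

End almost_everywhere.

(** * Representatives in the measure algebra *)

Section measure_algebra_sets.
Context d (T : measurableType d) (R : realType).
Variable mu : {measure set T -> \bar R}.
Local Notation A := (malg mu).

Definition malg_set (a : A) : set T := repr a.

Lemma malg_set_measurable (a : A) : measurable (malg_set a).
Proof. exact: meassetP. Qed.

Lemma malg_setK (a : A) : malg_class mu (repr a) = a.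
Proof. exact: reprK. Qed.

Lemma malg_class_le (B C : measset T) :
  (malg_class mu B <= malg_class mu C)%O <->
  \forall w \ae mu, (B : set T) w -> (C : set T) w.
Proof.
have meetE : (malg_class mu B `&` malg_class mu C)%O =
  malg_class mu (meassetI B C) by exact: malg_meetE.
have mBC : measurable ((meassetI B C : set T) `+` B).
  by apply: measurableU; apply: measurableD; exact: meassetP.
rewrite leEmeet meetE; split=> [/eqP/eqP|h].
  rewrite eqmodE => /asboolP /(negligibleP _ mBC).
  apply: negligibleS => w /= /not_implyP[Bw nC]; right; split=> //.
  by case.
apply/eqP/eqP; rewrite eqmodE; apply/asboolP/(negligibleP _ mBC).
apply: negligibleS h => w /= [[[Bw _] nB]//|[Bw nBC]] BC.
by apply: nBC; split=> //; exact: BC.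
Qed.

Lemma malg_leP (a b : A) :
  (a <= b)%O <-> \forall w \ae mu, malg_set a w -> malg_set b w.
Proof. by rewrite -{1}(malg_setK a) -{1}(malg_setK b);
  exact: malg_class_le. Qed.

Lemma malg_eqP (a b : A) :
  a = b <-> \forall w \ae mu, malg_set a w <-> malg_set b w.
Proof.
split=> [->|ab]; first exact: aeW.
apply/eqP; rewrite eq_le; apply/andP.
by split; apply/malg_leP; apply: filterS ab => w [].
Qed.

Lemma malg_set_class (B : measset T) :
  \forall w \ae mu, malg_set (malg_class mu B) w <-> (B : set T) w.
Proof.
have le1 := malg_class_le (repr (malg_class mu B)) B.
have le2 := malg_class_le B (repr (malg_class mu B)).
rewrite malg_setK in le1 le2.
by apply: filterS2 (le1.1 (lexx _)) (le2.1 (lexx _)) => w ? ?; split.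
Qed.

Lemma malg_setI (a b : A) :
  \forall w \ae mu, malg_set (a `&` b)%O w <-> malg_set a w /\ malg_set b w.
Proof.
have -> : (a `&` b)%O = malg_class mu (meassetI (repr a) (repr b)) by [].
exact: malg_set_class.
Qed.

Lemma malg_set0 : \forall w \ae mu, ~ malg_set (\bot%O : A) w.
Proof. by apply: filterS (malg_set_class (Measset measurable0)) =>
  w [h _] /h. Qed.

Lemma malg_setT : \forall w \ae mu, malg_set (\top%O : A) w.
Proof.
by apply: filterS (malg_set_class (Measset measurableT)) => w [_]; apply.
Qed.

Lemma malg_eq0P (a : A) : a = \bot%O <-> \forall w \ae mu, ~ malg_set a w.
Proof.
split=> [->|a0]; first exact: malg_set0.
by apply/malg_eqP; apply: filterS2 a0 malg_set0 => w.
Qed.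

End measure_algebra_sets.

(** * The countable chain condition *)

Section countable_chain_condition.
Context d (T : measurableType d) (R : realType).
Variable mu : {measure set T -> \bar R}.

(** A set of finite measure has no room for infinitely many almost disjoint pieces of measure above
    $1/(n+1)$: the union of [N] of them has measure at least $N/(n+1)$. *)
Lemma ae_disjoint_finite (I : Type) (S : I -> set T) (F : set T) (n : nat) :
  measurable F -> (mu F < +oo)%E -> (forall i, measurable (S i)) ->
  (forall i j, i <> j -> mu (S i `&` S j) = 0%E) ->
  finite_set [set i | (n.+1%:R^-1%:E < mu (F `&` S i))%E].
Proof.
(* Extracting an injective sequence from an infinite set of indices needs a pointed type; over an
   empty type there is nothing to prove. *)
elim/Ppointed: I => I in S *.
  by move=> *; rewrite emptyE.
move=> mF Foo mS S0; apply: contrapT.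
move=> /infiniteP/pcard_leP/injfunPex[/= q q_fun q_inj].
pose G k := F `&` S (q k); pose U N := \big[setU/set0]_(k < N) G k.
have mG k : measurable (G k) by exact: measurableI.
have mU N : measurable (U N) by exact: bigsetU_measurable.
have UF N : U N `<=` F by rewrite /U -bigcup_mkord => w [k _ []].
have UG N : mu (U N `&` G N) = 0%E.
  apply: measure_negligible; first exact: measurableI.
  rewrite /U -bigcup_mkord setI_bigcupl bigcup_mkord.
  rewrite -(big_mkord xpredT (fun i => G i `&` G N)) big_nat_cond.
  apply: negligible_bigsetU => k /andP[/andP[_ kN] _].
  apply: (@negligibleS _ _ _ _ (S (q k) `&` S (q N))) => [w [[? ?] [? ?]]//|].
  apply/negligibleP; first exact: measurableI.
  apply: S0 => /q_inj; rewrite !in_setT => /(_ isT isT) kNE.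
  by rewrite kNE ltnn in kN.
have U_ge N : ((N%:R * n.+1%:R^-1)%:E <= mu (U N))%E.
  elim: N => [|N IH]; first by rewrite mul0r measure_ge0.
  rewrite /U big_ord_recr /= -/(U N) measureUfinl//; last first.
    by apply: le_lt_trans Foo; apply: le_measure; rewrite ?inE.
  rewrite UG sube0 -natr1 mulrDl mul1r EFinD.
  by apply: leeD => //; apply: ltW; exact: q_fun.
have UFoo N : (mu (U N) <= (fine (mu F))%:E)%E.
  rewrite fineK ?ge0_fin_numE ?measure_ge0//.
  by apply: le_measure; rewrite ?inE.
(* This number of pieces exceeds $(n+1)\mu(F)$, so their union would be larger than [F]. *)
have := le_trans (U_ge (Num.trunc (fine (mu F) * n.+1%:R)).+1) (UFoo _).
by rewrite lee_fin ler_pdivrMr ?ltr0n// leNgt truncnS_gt.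
Qed.

(** A piece of positive measure meets some member [F n] of the exhaustion in measure above some
    $1/(m+1)$, and for each pair [n], [m] only finitely many pieces do. *)
Lemma ae_disjoint_countable (I : Type) (S : I -> set T) :
  sigma_finite setT mu -> (forall i, measurable (S i)) ->
  (forall i j, i <> j -> mu (S i `&` S j) = 0%E) ->
  countable [set i | mu (S i) <> 0%E].
Proof.
move=> [F FT F_fin] mS S0.
have sub : [set i | mu (S i) <> 0%E] `<=` \bigcup_n \bigcup_m
    [set i | (m.+1%:R^-1%:E < mu (F n `&` S i))%E].
  move=> i Si; apply: contrapT => no; apply: Si.
  apply: measure_negligible => //.
  rewrite -(setTI (S i)) FT setI_bigcupl; apply: negligible_bigcup => n.
  have mFS : measurable (F n `&` S i).
    by apply: measurableI => //; exact: (F_fin n).1.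
  apply/negligibleP => //; apply: contrapT => FS0; apply: no; exists n => //.
  have FSoo : (mu (F n `&` S i) < +oo)%E.
    apply: le_lt_trans (F_fin n).2; apply: le_measure; rewrite ?inE//.
    exact: (F_fin n).1.
  have : 0 < fine (mu (F n `&` S i)).
    by rewrite fine_gt0// FSoo andbT measure_gt0; apply/eqP.
  move=> /ltr_add_invr[k]; rewrite add0r => kS; exists k => //=.
  rewrite -[mu _]fineK ?lte_fin//.
  by rewrite ge0_fin_numE// measure_ge0.
move: sub => /subset_card_le/sub_countable; apply.
apply: bigcup_countable => // n _; apply: bigcup_countable => // m _.
apply: finite_set_countable; apply: ae_disjoint_finite => //.
- exact: (F_fin n).1.
- exact: (F_fin n).2.
Qed.

Hypothesis mu_complete : measure_is_complete mu.
Hypothesis mu_sigma_finite : sigma_finite setT mu.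
Hypothesis mu_gt0 : (0 < mu setT)%E.

(** [h w] names the piece that contains [w]. The pieces of positive measure are countably many by
    the chain condition, and they alone cover almost every point. *)
Lemma partition_index (I : Type) (a : I -> malg mu) : is_partition a ->
  exists2 h : T -> I, countably_valued h &
    forall i, \forall w \ae mu, h w = i <-> malg_set (a i) w.
Proof.
move=> [a_disj [_ a_lub]].
pose S i := malg_set (a i); pose J := [set i | mu (S i) <> 0%E].
have mS i : measurable (S i) by exact: malg_set_measurable.
have S_disj i j : i <> j -> mu (S i `&` S j) = 0%E.
  move=> ij; apply: measure_negligible; first exact: measurableI.
  have := malg_setI (a i) (a j); rewrite (a_disj _ _ ij) => aij.
  have : \forall w \ae mu, ~ (S i w /\ S j w).
    by apply: filterS2 aij (malg_set0 mu) => w [_ h] nw /h.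
  by apply: negligibleS => w /= ? ?.
have cJ : countable J by exact: ae_disjoint_countable.
have cover : \forall w \ae mu, exists2 i, J i & S i w.
  have mU : measurable (\bigcup_(i in J) S i).
    exact: countable_bigcup_measurable.
  (* The union over [J] is an upper bound of every [a i], null pieces included, so it lies above
     their supremum. *)
  have : (\top <= malg_class mu (Measset mU))%O.
    apply: a_lub => _ [i _ <-]; rewrite -(malg_setK (a i)).
    apply/malg_class_le; have [Si0|Si0] := pselect (mu (S i) = 0%E).
      have /negligibleP-/(_ (mS i)) := Si0.
      by apply: negligibleS => w /= /not_implyP[].
    by apply: aeW => w Sw; exists i.
  move=> /malg_leP h; have := malg_set_class mu (Measset mU).
  apply: filterS3 h (malg_setT mu) => w h /h + [h1 _] => /h1[i Ji Sw].
  by exists i.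
have disj : \forall w \ae mu, forall i, J i -> forall j, J j ->
    S i w -> S j w -> i = j.
  apply: ae_countable => // i _; apply: ae_countable => // j _.
  have [->|ij] := pselect (i = j); first exact: aeW.
  have /negligibleP := S_disj _ _ ij.
  move=> /(_ (measurableI _ _ (mS i) (mS j))).
  by apply: negligibleS => w /= /not_implyP[? /not_implyP[]].
(* Positivity of the total measure supplies a default for the points that no piece covers; taking it
   in [J] keeps the range of [h] countable. *)
have [i0 Ji0] : exists i, J i.
  apply: contrapT => noJ; move: mu_gt0; rewrite lt_neqAle => /andP[/eqP + _].
  apply; apply/esym/measure_negligible => //.
  by apply: negligibleS cover => w _ [i Ji _]; apply: noJ; exists i.
have [h hP0] : {h : T -> I &
    forall w, J (h w) /\ ((exists2 i, J i & S i w) -> S (h w) w)}.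
  apply: (@choice _ _ (fun w i => J i /\ ((exists2 j, J j & S j w) -> S i w)))
    => w.
  have [[i Ji Sw]|no] := pselect (exists2 i, J i & S i w); first by exists i.
  by exists i0.
have hJ w : J (h w) by have [] := hP0 w.
have hP : \forall w \ae mu, S (h w) w.
  by apply: filterS cover => w cw; have [_] := hP0 w; exact.
have h_iff i : \forall w \ae mu, h w = i <-> S i w.
  have [Si0|Ji] := pselect (mu (S i) = 0%E).
    have /negligibleP-/(_ (mS i)) := Si0.
    apply: negligibleS => w nh; apply: contrapT => nS; apply: nh;
      split=> // hwi.
    by have := hJ w; rewrite hwi => /(_ Si0).
  apply: filterS2 hP disj => w Sh djw; split=> [<-//|Siw].
  exact: djw (hJ w) _ Ji Sh Siw.
exists h => //; split=> [|i].
  have : range h `<=` J by move=> _ [w _ <-]; exact: hJ.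
  by move=> /subset_card_le/sub_countable; apply.
by apply: (ae_measurable mu_complete (mS i)); apply: filterS (h_iff i) => w [].
Qed.

End countable_chain_condition.

(** * Strong measurability *)

Lemma invS_lt (R : realType) (e : R) : 0 < e -> exists j, j.+1%:R^-1 < e.
Proof. by move=> /ltr_add_invr[j]; rewrite add0r; exists j. Qed.

Lemma invS_gt0 (R : realType) (j : nat) : 0 < j.+1%:R^-1 :> R.
Proof. by rewrite invr_gt0 ltr0n. Qed.

Section sequences.
Context (R : realType) (X : normedModType R).
Implicit Types (u : nat -> X) (l : X).

Lemma seq_cvgP u l : u @ \oo --> l <->
  forall e : R, 0 < e -> exists N, forall k, (N <= k)%N -> `|l - u k| < e.
Proof.
split=> [/cvgrPdist_lt h e /h[N _ hN]|h].
  by exists N => k Nk; exact: hN.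
by apply/cvgrPdist_lt => e /h[N hN]; exists N.
Qed.

Lemma seq_cvg_invS u l :
  (forall j : nat, exists N, forall k, (N <= k)%N -> `|l - u k| < j.+1%:R^-1) ->
  u @ \oo --> l.
Proof.
move=> h; apply/seq_cvgP => e /invS_lt[j je]; have [N hN] := h j.
by exists N => k /hN /lt_trans; apply.
Qed.

Lemma seq_cvg_cauchy u : cvg (u @ \oo) -> forall e : R, 0 < e ->
  exists N, forall k m, (N <= k)%N -> (N <= m)%N -> `|u k - u m| < e.
Proof.
move=> /seq_cvgP h e e0; have /h[N hN] : 0 < e / 2 by rewrite divr_gt0.
exists N => k m /hN kN /hN mN; rewrite (splitr e).
have -> : u k - u m = (u k - lim (u @ \oo)) + (lim (u @ \oo) - u m).
  by rewrite addrA subrK.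
by apply: le_lt_trans (ler_normD _ _) _; rewrite distrC ltrD.
Qed.

End sequences.

Lemma seq_cauchy_cvg (R : realType) (X : completeNormedModType R)
  (u : nat -> X) :
  (forall j : nat, exists N, forall k l,
    (N <= k)%N -> (N <= l)%N -> `|u k - u l| < j.+1%:R^-1) ->
  cvg (u @ \oo).
Proof.
move=> h; apply: cauchy_cvg; apply: cauchy_exP => e /invS_lt[j je].
have [N hN] := h j; exists (u N), N => // k /= Nk.
by rewrite -ball_normE /=; apply: lt_trans je; apply: hN.
Qed.

Section strong_measurability.
Context d (T : measurableType d) (R : realType).
Variable mu : {measure set T -> \bar R}.
Hypothesis mu_complete : measure_is_complete mu.
Variable X : normedModType R.
Implicit Types x : T -> X.

(** At [w] the approximation is [f (h w) w], where [h w] is an index beyond which the sequence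
    oscillates by less than [e]; passing to the limit weakens the bound to a large inequality. *)
Lemma countably_valued_approx (f : nat -> T -> X) x (e : R) : 0 < e ->
  (forall k, countably_valued (f k)) ->
  (\forall w \ae mu, f ^~ w @ \oo --> x w) ->
  exists2 c, countably_valued c & \forall w \ae mu, `|x w - c w| <= e.
Proof.
move=> e0 cf fx.
(* Terms are compared with each other and not with [x], whose measurability is not at hand: [P k l]
   is the fiber over [true] of a countably valued boolean function. *)
pose P k l := [set w | `|f k w - f l w| < e].
have mP k l : measurable (P k l).
  have := countably_valued_comp2 (fun u v : X => `|u - v| < e) (cf k) (cf l).
  by move=> [_ /(_ true)].
pose Q N := \bigcap_(k in [set k | (N <= k)%N])
  \bigcap_(l in [set l | (N <= l)%N]) P k l.
have mQ N : measurable (Q N).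
  by apply: bigcap_measurableType => k _; apply: bigcap_measurableType.
have eQ : \forall w \ae mu, exists N, Q N w.
  apply: filterS fx => w fx; have /seq_cvg_cauchy/(_ _ e0)[N hN] : cvg
    (f ^~ w @ \oo).
    by apply: cvgP fx.
  by exists N => k Nk l Nl; exact: hN.
have [h ch hQ] := ae_measurable_select mu_complete mQ eQ.
exists (fun w => f (h w) w); first exact: countably_valued_diag.
apply: filterS2 fx hQ => w fx hQ.
have : (fun k => `|f k w - f (h w) w|) @ \oo --> `|x w - f (h w) w|.
  by apply: cvg_norm; apply: cvgB => //; exact: cvg_cst.
move=> /cvgr_to_le; apply; exists (h w) => // k /= hk; apply: ltW.
by apply: hQ => /=.
Qed.

(* The values of the c k form a countable set, numbered by [i]. The n-th simple
   function takes the value c j w for the largest j <= n such that this value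
   has number at most n, so that its range is finite; as n grows, every fixed j
   is eventually eligible. *)
Let search (i : X -> nat) (c : nat -> T -> X) (n : nat) :=
  fix search (j : nat) (w : T) : X :=
    if (i (c j w) <= n)%N then c j w
    else if j is j'.+1 then search j' w else 0.

Lemma strongly_measurable_of_approx (c : nat -> T -> X) x :
  (forall k, countably_valued (c k)) ->
  (forall k, \forall w \ae mu, `|x w - c k w| <= k.+1%:R^-1) ->
  strongly_measurable mu x.
Proof.
move=> cc xc.
pose V := \bigcup_k range (c k).
have /countable_injP[i iI] : countable V.
  by apply: bigcup_countable => // k _; exact: (cc k).1.
have cv_search n j : countably_valued (search i c n j).
  elim: j => [|j IH] /=.
    exact: (countably_valued_comp (fun v => if (i v <= n)%N then v else 0)).
  exact: (countably_valued_comp2 (fun v v' => if (i v <= n)%N then v else v')).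
exists (fun n => search i c n n) => [n|].
  split; last exact: (cv_search n n).2.
  have fin : finite_set [set v | V v /\ (i v <= n)%N].
    rewrite -(eq_finite_set (inj_card_eq (f := i) _)).
      apply: sub_finite_set (finite_II n.+1) => _ [v [_ vn] <-] /=.
      by rewrite ltnS.
    by move=> u v /set_mem[Vu _] /set_mem[Vv _]; apply: iI; exact: mem_set.
  apply: (@sub_finite_set _ _ ([set 0] `|` [set v | V v /\ (i v <= n)%N]));
    last first.
    by rewrite finite_setU.
  suff h j w : ([set 0] `|` [set v | V v /\ (i v <= n)%N]) (search i c n j w).
    by move=> _ [w _ <-].
  elim: j => [|j IH] /=; case: ifPn => // ci.
  - by right; split=> //; exists 0%N => //; exists w.
  - by left.
  - by right; split=> //; exists j.+1 => //; exists w.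
have := ae_foralln xc; apply: filterS => w {}xc; apply: seq_cvg_invS => j.
(* From [N] on, the search starts at [j.+1] or above and finds [c j.+1 w] eligible, so it stops no
   lower. Aiming at [j.+1] instead of [j] makes the resulting bound $1/(j+2)$ strictly smaller than
   $1/(j+1)$. *)
pose N := maxn j.+1 (i (c j.+1 w)); exists N => n Nn.
suff h m : (j < m)%N -> `|x w - search i c n m w| <= j.+2%:R^-1.
  apply: le_lt_trans (h n _) _; first by apply: leq_trans Nn; exact: leq_maxl.
  by rewrite ltf_pV2 ?posrE ?ltr0n// ltr_nat.
elim: m => // m IH; rewrite ltnS leq_eqVlt => /predU1P[<-|jm] /=.
  by rewrite (leq_trans (leq_maxr _ _) Nn).
case: ifPn => _; last exact: IH.
apply: le_trans (xc m.+1) _; rewrite lef_pV2 ?posrE ?ltr0n// ler_nat.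
by rewrite !ltnS ltnW.
Qed.

(** A finite range is lost when functions are glued along a countable partition, a countable one is
    not. The converse first turns pointwise convergence into uniform bounds $1/(k+1)$. *)
Lemma strongly_measurableP x : strongly_measurable mu x <->
  exists2 c : nat -> T -> X, (forall k, countably_valued (c k)) &
    \forall w \ae mu, c ^~ w @ \oo --> x w.
Proof.
split=> [[s ss sx]|[c cc cx]].
  exists s => // k; have [fs ms] := ss k; split=> //.
  exact: finite_set_countable.
have /choice[f fP] : forall k : nat, exists f, countably_valued f /\
    \forall w \ae mu, `|x w - f w| <= k.+1%:R^-1.
  move=> k; have [f cf fx] := countably_valued_approx (invS_gt0 R k) cc cx.
  by exists f.
by apply: (@strongly_measurable_of_approx f) => k; have [] := fP k.
Qed.

Lemma strongly_measurable_approx x (e : R) :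
  0 < e -> strongly_measurable mu x ->
  exists2 c, countably_valued c & \forall w \ae mu, `|x w - c w| <= e.
Proof.
by move=> e0 /strongly_measurableP[c]; exact: countably_valued_approx.
Qed.

(** Replacing [f k] by a countably valued function within $1/(k+1)$ does not change the limit. *)
Lemma strongly_measurable_lim (f : nat -> T -> X) x :
  (forall k, strongly_measurable mu (f k)) ->
  (\forall w \ae mu, f ^~ w @ \oo --> x w) -> strongly_measurable mu x.
Proof.
move=> mf fx; have /choice[c cP] : forall k : nat, exists c,
  countably_valued c /\
    \forall w \ae mu, `|f k w - c w| <= k.+1%:R^-1.
  move=> k; have [c cc fc] := strongly_measurable_approx (invS_gt0 R k) (mf k).
  by exists c.
apply/strongly_measurableP; exists c => [k|]; first by have [] := cP k.
have : \forall w \ae mu, forall k, `|f k w - c k w| <= k.+1%:R^-1.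
  by apply: ae_foralln => k; have [] := cP k.
apply: filterS2 fx => w fx fc; apply/seq_cvgP => e e0.
have /seq_cvgP/(_ (e / 2))[|N hN] := fx; first by rewrite divr_gt0.
have /invS_lt[j je] : 0 < e / 2 by rewrite divr_gt0.
exists (maxn N j) => k; rewrite geq_max => /andP[/hN Nk jk].
have -> : x w - c k w = (x w - f k w) + (f k w - c k w) by rewrite addrA subrK.
rewrite (splitr e); apply: le_lt_trans (ler_normD _ _) _; apply: ltrD => //.
apply: le_lt_trans (fc k) _; apply: le_lt_trans je.
by rewrite lef_pV2 ?posrE ?ltr0n// ler_nat.
Qed.

Lemma strongly_measurable_glue (I : Type) (h : T -> I) (x : I -> T -> X) :
  countably_valued h -> (forall i, strongly_measurable mu (x i)) ->
  strongly_measurable mu (fun w => x (h w) w).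
Proof.
move=> ch mx; have /choice[c cP] : forall i, exists c : nat -> T -> X,
    (forall k, countably_valued (c k)) /\ \forall w \ae mu,
      c ^~ w @ \oo --> x i w.
  by move=> i; have /strongly_measurableP[c cc cx] := mx i; exists c.
apply/strongly_measurableP; exists (fun k w => c (h w) k w) => [k|].
  by apply: (countably_valued_diag (g := fun i w => c i k w)) => // i;
    have [] := cP i.
apply: (ae_fibers ch) => i; have [_] := cP i.
by apply: filterS => w cx ->.
Qed.

Lemma countably_valued_measurable d' (U : measurableType d') (f : T -> U) :
  countably_valued f -> measurable_fun setT f.
Proof.
move=> cf _ B _; rewrite setTI.
apply: (diag_measurable (Q := fun u => [set _ : T | B u]) cf) => u.
have [Bu|nBu] := pselect (B u).
  by rewrite (_ : [set _ | _] = setT)//; apply/seteqP; split.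
by rewrite (_ : [set _ | _] = set0)//; apply/seteqP; split.
Qed.

Lemma ae_cvg_measurable (f : nat -> T -> R) (g : T -> R) :
  (forall k, measurable_fun setT (f k)) ->
  (\forall w \ae mu, f ^~ w @ \oo --> g w) -> measurable_fun setT g.
Proof.
move=> mf fg; set N := ~` [set w | f ^~ w @ \oo --> g w].
have mN (A : set T) : A `<=` N -> measurable A.
  by move=> AN; apply: mu_complete; apply: negligibleS fg.
have mNN := mN _ (@subset_refl _ N).
rewrite -(setvU N); apply/measurable_funU => //; first exact: measurableC.
split; last by move=> _ B _; apply: mN => w [].
apply: (@measurable_fun_cvg _ _ _ _ f) => [k|w].
  by apply: measurable_funS (mf k).
by move=> /contrapT.
Qed.

Lemma measurable_norm x : strongly_measurable mu x ->
  measurable_fun setT (fun w => `|x w|).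
Proof.
move=> /strongly_measurableP[c cc cx].
apply: (@ae_cvg_measurable (fun k w => `|c k w|)) => [k|].
  by apply: countably_valued_measurable; exact: countably_valued_comp.
by apply: filterS cx => w cx; exact: cvg_norm.
Qed.

End strong_measurability.

Lemma strongly_measurable_comp2 d (T : measurableType d) (R : realType)
    (mu : {measure set T -> \bar R}) (X Y Z : normedModType R)
    (F : X -> Y -> Z) (x : T -> X) (y : T -> Y) :
  measure_is_complete mu ->
  (forall (u : nat -> X) (v : nat -> Y) a b, u @ \oo --> a -> v @ \oo --> b ->
    (fun n => F (u n) (v n)) @ \oo --> F a b) ->
  strongly_measurable mu x -> strongly_measurable mu y ->
  strongly_measurable mu (fun w => F (x w) (y w)).
Proof.
move=> cmu Fc /(strongly_measurableP cmu)[c cc cx]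
  /(strongly_measurableP cmu)[e ce ey].
apply/(strongly_measurableP cmu); exists (fun k w => F (c k w) (e k w)) => [k|].
  exact: countably_valued_comp2.
by apply: filterS2 cx ey => w; exact: Fc.
Qed.

(** Rounding down to multiples of $1/(k+1)$ gives the countably valued approximations. Scalars can
    then be treated as functions with values in the normed module [R^o]. *)
Lemma measurable_strongly_measurable d (T : measurableType d) (R : realType)
    (mu : {measure set T -> \bar R}) (r : T -> R) :
  measurable_fun setT r -> strongly_measurable mu (r : T -> R^o).
Proof.
move=> mr; pose c k w : R^o := (Num.floor (r w * k.+1%:R))%:~R / k.+1%:R.
have cfloor k : countably_valued (fun w => Num.floor (r w * k.+1%:R)).
  split=> [|z]; first exact: countableP.
  rewrite [X in measurable X](_ : _ =
      (fun w => r w * k.+1%:R) @^-1` `[z%:~R, (z + 1)%:~R[%classic).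
    have : measurable_fun setT (fun w => r w * k.+1%:R).
      by apply: measurable_funM => //; exact: measurable_cst.
    move=> /(_ measurableT `[z%:~R, (z + 1)%:~R[%classic (measurable_itv _)).
    by rewrite setTI.
  apply/seteqP; split=> w /=; rewrite in_itv /=.
    by move=> <-; rewrite floor_itv.
  exact: floor_def.
apply: (@strongly_measurable_of_approx _ _ _ _ R^o c) => k.
  exact: (countably_valued_comp (fun z : int => z%:~R / k.+1%:R : R^o)).
apply: aeW => w; have k0 : (0 : R) < k.+1%:R by rewrite ltr0n.
rewrite /c -[X in _ <= X]mul1r ler_pdivlMr// -[X in _ * X]gtr0_norm// -normrM.
rewrite mulrBl divfK ?gt_eqF// ger0_norm ?subr_ge0 ?floor_le_tmp//.
by rewrite lerBlDl ltW// -intrD1 floorD1_gt.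
Qed.

(** * Pointwise realizations of conditional sets *)

Section realization.
Context d (T : measurableType d) (R : realType).
Variable mu : {measure set T -> \bar R}.

(* Each conditional set of the theorem is a set of functions on T, up to null
   sets: [rho] sends an element to the function it stands for, and x|a is then
   determined by the restriction of [rho x] to a. *)
Definition realized (E : condset mu) (V : Type) (rho : E -> T -> V) : Prop :=
  forall (x y : E) a b, cond x a = cond y b <->
    a = b /\ \forall w \ae mu, malg_set a w -> rho x w = rho y w.

Lemma realized_of (E V : Type) (agree : malg mu -> E -> E -> Prop)
    (rho : E -> T -> V) :
  (forall a x y, agree a x y <->
    \forall w \ae mu, malg_set a w -> rho x w = rho y w) ->
  @realized (condset_of agree) V rho.
Proof.
move=> agreeP x y a b; split=> [[<- /seteqP[_ /(_ y) /= xy]]|[<- xy]].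
  by split=> //; apply/agreeP/xy/agreeP; exact: aeW.
congr pair; apply/seteqP; split=> z /= /agreeP h; apply/agreeP.
  by apply: filterS2 xy h => w xy xz aw; rewrite -xy// xz.
by apply: filterS2 xy h => w xy yz aw; rewrite xy// yz.
Qed.

Lemma realized_prod (E F : condset mu) (V W : Type) (rho : E -> T -> V)
    (sigma : F -> T -> W) : realized rho -> realized sigma ->
  @realized (condset_prod E F) _ (fun p w => (rho p.1 w, sigma p.2 w)).
Proof.
move=> rhoP sigmaP [x u] [y v] a b /=; split.
  by move=> [/rhoP[-> xy] /sigmaP[_ uv]]; split=> //;
    apply: filterS2 xy uv => w xy uv aw; rewrite xy// uv.
move=> [ab xy]; congr pair; [apply/rhoP|apply/sigmaP]; split=> //;
  by apply: filterS xy => w /[apply] -[].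
Qed.

Lemma is_concatP (E : condset mu) (V : Type) (rho : E -> T -> V) (I : Type)
    (a : I -> malg mu) (x_ : I -> E) (x : E) : realized rho ->
  is_concat a x_ x <->
  forall i, \forall w \ae mu, malg_set (a i) w -> rho x w = rho (x_ i) w.
Proof.
move=> rhoP; split=> [cx i|h i]; first by have /rhoP[] := cx i.
by apply/rhoP; split.
Qed.

(** A map whose value at [w] depends only on [w] and on the value of its argument there respects
    restriction to each piece. [Phi] may depend on [w], which serves for sequences [f k w]. *)
Lemma stable_pointwise (E F : condset mu) (V W : Type) (rho : E -> T -> V)
    (sigma : F -> T -> W) (f : E -> F) (Phi : T -> V -> W) :
  realized rho -> realized sigma ->
  (forall x, \forall w \ae mu, sigma (f x) w = Phi w (rho x w)) -> stable f.
Proof.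
move=> rhoP sigmaP fE I a x_ x pa /(is_concatP _ _ _ rhoP) h.
apply/(is_concatP _ _ _ sigmaP) => i.
by apply: filterS3 (fE x) (fE (x_ i)) (h i) => w -> -> /[apply] ->.
Qed.

End realization.

Section theorem.
Context d (T : measurableType d) (R : realType).
Variable mu : {measure set T -> \bar R}.
Hypothesis mu_complete : measure_is_complete mu.
Hypothesis mu_sigma_finite : sigma_finite setT mu.
Hypothesis mu_gt0 : (0 < mu setT)%E.

Lemma index_partition (I : Type) (a : I -> malg mu) (h : T -> I) :
  countably_valued h ->
  (forall i, \forall w \ae mu, h w = i <-> malg_set (a i) w) -> is_partition a.
Proof.
move=> ch hP; split=> [i j ij|].
  apply/malg_eq0P; apply: filterS3 (malg_setI (a i) (a j)) (hP i) (hP j) => w.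
  by move=> aij hi hj /aij[/hi wi /hj wj]; apply: ij; rewrite -wi -wj.
split=> [b _|b bP]; first exact: lex1.
apply/malg_leP; apply: (ae_fibers ch) => i.
have /malg_leP : (a i <= b)%O by apply: bP; exists i.
by apply: filterS2 (hP i) => w [h1 _] ab /h1/ab.
Qed.

(** (C1) and (C2) are immediate for restrictions of functions. In (C3), existence is gluing along
    the index function of the partition, and uniqueness is checked on its fibers. *)
Lemma realized_condset (E : condset mu) (V : Type) (rho : E -> T -> V) :
  realized rho -> inhabited E ->
  (forall x y, (\forall w \ae mu, rho x w = rho y w) -> x = y) ->
  (forall (I : Type) (h : T -> I) (x_ : I -> E), countably_valued h ->
    exists x, \forall w \ae mu, rho x w = rho (x_ (h w)) w) ->
  is_condset E.
Proof.
move=> rhoP E0 rho_inj glue; split=> //.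
- by move=> x y a b /rhoP[].
- move=> x y a b /rhoP[_ xy] ab; apply/rhoP; split=> //.
  by move/malg_leP : ab; apply: filterS2 xy => w xy ab /ab/xy.
- move=> I a x_ pa.
  have [h ch hP] := partition_index mu_complete mu_sigma_finite mu_gt0 pa.
  have [x xE] := glue _ _ x_ ch; exists x; split.
    apply/(is_concatP _ _ _ rhoP) => i.
    by apply: filterS2 xE (hP i) => w -> hi /hi ->.
  move=> y /(is_concatP _ _ _ rhoP) yP; apply: rho_inj.
  apply: (ae_fibers ch) => i.
  by apply: filterS3 xE (yP i) (hP i) => w -> yi hi wi; rewrite yi -?hi// wi.
Qed.

(** * Step functions as countably valued functions *)

Section steps.
Variable E : pointedType.
Implicit Types (f g : step mu E) (h : T -> E).

Lemma step_partition f : is_partition f.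
Proof. exact: set_mem (valP f). Qed.

(** A step function is stored as the partition of its level sets, indexed by the values, so its
    index function is the function it stands for. *)
Definition step_rep f : T -> E := s2val (cid2
  (partition_index mu_complete mu_sigma_finite mu_gt0 (step_partition f))).

Lemma step_rep_cv f : countably_valued (step_rep f).
Proof. by rewrite /step_rep; case: cid2. Qed.

Lemma step_repP f z :
  \forall w \ae mu, step_rep f w = z <-> malg_set (f z) w.
Proof. by rewrite /step_rep; case: cid2. Qed.

Lemma step_agreeP a f g : step_agree a f g <->
  \forall w \ae mu, malg_set a w -> step_rep f w = step_rep g w.
Proof.
split=> [fg|fg z].
  apply: (ae_fibers (step_rep_cv f)) => z.
  have /malg_eqP := fg z; apply: filter_app.
  apply: filter_app (step_repP f z); apply: filter_app (step_repP g z).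
  apply: filterS2 (malg_setI (f z) a) (malg_setI (g z) a) => w.
  move=> fza gza gz fz fgz wz aw; rewrite wz; apply/esym/gz.
  by apply: (gza.1 _).1; apply/fgz/fza; split=> //; exact/fz.
apply/malg_eqP; apply: filter_app fg.
apply: filter_app (step_repP f z); apply: filter_app (step_repP g z).
apply: filterS2 (malg_setI (f z) a) (malg_setI (g z) a) => w fza gza gz fz fg.
apply: (iff_trans fza); apply: iff_sym; apply: (iff_trans gza).
by split=> -[/[dup] zw + aw]; [move/gz|move/fz] => wz; split=> //;
  [apply/fz; rewrite fg|apply/gz; rewrite -fg].
Qed.

(** Choosing with a default makes this total, so that no proof of measurability enters the term. *)
Definition step_fun h : step mu E :=
  xget (step_cst mu point) [set f | \forall w \ae mu, step_rep f w = h w].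

Lemma step_repE f h : (forall z, \forall w \ae mu,
  h w = z <-> malg_set (f z) w) ->
  \forall w \ae mu, step_rep f w = h w.
Proof.
move=> hP; apply: (ae_fibers (step_rep_cv f)) => z.
by apply: filterS2 (step_repP f z) (hP z) => w fz hz wz; rewrite wz;
  apply/esym/hz/fz.
Qed.

Lemma step_funE h : countably_valued h ->
  \forall w \ae mu, step_rep (step_fun h) w = h w.
Proof.
move=> ch; pose a z := malg_class mu (Measset (ch.2 z)).
have aP z : \forall w \ae mu, h w = z <-> malg_set (a z) w.
  by apply: filterS (malg_set_class mu (Measset (ch.2 z))) => w; tauto.
have pa := index_partition ch aP.
pose f : step mu E := SigSub (mem_set (pa : [set f : E -> malg mu |
  is_partition f] _)).
have : \forall w \ae mu, step_rep f w = h w by exact: step_repE.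
move=> fh.
exact: (xgetPex (P := [set f | \forall w \ae mu, step_rep f w = h w]) _
  (ex_intro _ f fh)).
Qed.

Lemma step_rep_cst (e : E) : \forall w \ae mu, step_rep (step_cst mu e) w = e.
Proof.
apply: (step_repE (h := fun=> e)) => z; rewrite /step_at /=.
case: eqVneq => [->|ze]; first by apply: filterS (malg_setT mu).
by apply: filterS (malg_set0 mu) => w; split=> // ez; rewrite ez eqxx in ze.
Qed.

Lemma step_rep_of (I : Type) (x : I -> E) (a : I -> malg mu) (h : T -> I) :
  countably_valued h ->
  (forall i, \forall w \ae mu, h w = i <-> malg_set (a i) w) ->
  \forall w \ae mu, step_rep (step_of x a) w = x (h w).
Proof.
move=> ch hP; have cxh := countably_valued_comp x ch.
pose b z := malg_class mu (Measset (cxh.2 z)).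
have bP z : \forall w \ae mu, x (h w) = z <-> malg_set (b z) w.
  by apply: filterS (malg_set_class mu (Measset (cxh.2 z))) => w; tauto.
have pb := index_partition cxh bP.
apply: step_repE => z.
(* The suprema in [step_of] are the classes of the level sets of [x (h w)]; these form a partition,
   so [insubd] does not fall back on its default. *)
rewrite /step_at /step_of [X in insubd _ X](_ : _ = b) ?insubdK//;
  first exact: mem_set.
apply/funext => z' {z}; have [S0|/set0P S0] := eqVneq [set i | x i = z'] set0.
  rewrite S0 image_set0 supremum0; apply/esym/malg_eq0P.
  apply: filterS (bP z') => w xz /xz xhz.
  by suff : [set i | x i = z'] (h w); [rewrite S0|].
apply: supremum_eq; first by case: S0 => i xi; exists (a i), i.
split=> [_ [i xi <-]|c cP]; apply/malg_leP.
  by apply: filterS2 (hP i) (bP z') => w hi bz /hi wi; apply/bz; rewrite wi.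
apply: (ae_fibers ch) => i; have [xi|xi] := pselect (x i = z').
  have /malg_leP : (a i <= c)%O by apply: cP; exists i.
  by apply: filterS2 (hP i) => w hi ac /hi/ac.
by apply: filterS (bP z') => w bz wi /bz; rewrite wi => /xi.
Qed.

End steps.

Lemma step_rep_map (E F : pointedType) (h : E -> F) (f : step mu E) :
  \forall w \ae mu, step_rep (step_map h f) w = h (step_rep f w).
Proof. exact: step_rep_of (step_rep_cv f) (step_repP f). Qed.

Lemma step_rep_map2 (E F G : pointedType) (h : E -> F -> G) (f : step mu E)
    (g : step mu F) : \forall w \ae mu,
  step_rep (step_map2 h f g) w = h (step_rep f w) (step_rep g w).
Proof.
apply: (step_rep_of (fun p => h p.1 p.2)
  (h := fun w => (step_rep f w, step_rep g w))).
  exact: countably_valued_comp2 (step_rep_cv f) (step_rep_cv g).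
move=> [u v] /=.
apply: filterS3 (malg_setI (f u) (g v)) (step_repP f u) (step_repP g v) => w.
move=> fgw fw gw; split=> [[wu wv]|/fgw[/fw <- /gw <-]//].
by apply/fgw; split; [apply/fw|apply/gw].
Qed.

(** A pair of values violating [r] has bottom meet, hence occurs on a null subset of [a] only, and
    countably many pairs occur at all. *)
Lemma step_relP (E F : pointedType) (r : E -> F -> Prop) (a : malg mu)
    (f : step mu E) (g : step mu F) : step_rel r a f g <->
  \forall w \ae mu, malg_set a w -> r (step_rep f w) (step_rep g w).
Proof.
have fgE u v : \forall w \ae mu, malg_set (f u `&` g v `&` a)%O w <->
    [/\ step_rep f w = u, step_rep g w = v & malg_set a w].
  apply: filter_app (step_repP f u); apply: filter_app (step_repP g v).
  apply: filterS2 (malg_setI (f u `&` g v)%O a) (malg_setI (f u) (g v)).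
  move=> w fga fg gv fu; split=> [/fga[/fg[/fu ? /gv ?] ?]//|[wu wv aw]].
  by apply/fga; split=> //; apply/fg; split; [apply/fu|apply/gv].
split=> [rfg|rfg u v].
  apply: (ae_fibers (step_rep_cv f)) => u.
  apply: (ae_fibers (step_rep_cv g)) => v.
  have [ruv|nruv] := pselect (r u v).
    by apply: aeW => w -> ->.
  have : (f u `&` g v `&` a)%O = \bot%O.
    by apply: contrapT => /eqP; rewrite -lt0x => /rfg.
  move=> /malg_eq0P; apply: filterS2 (fgE u v) => w h nh gv fu aw.
  by exfalso; apply: nh; apply/h.
rewrite lt0x => /eqP fga; apply: contrapT => nruv; apply: fga.
by apply/malg_eq0P; apply: filterS2 (fgE u v) rfg => w h rw /h[fu gv /rw];
  rewrite fu gv.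
Qed.

Lemma step_realized (E : pointedType) :
  @realized _ _ _ mu (condstep mu E) _ (@step_rep E).
Proof. by apply: realized_of => a f g; exact: step_agreeP. Qed.

(** * Conditional natural numbers and thresholds *)

Lemma condnat_leP (m n : condnat mu) : condnat_le m n <->
  \forall w \ae mu, (step_rep m w <= step_rep n w)%N.
Proof.
apply: (iff_trans (step_relP _ _ _ _)); split; last by apply: filterS.
by apply: filterS2 (malg_setT mu) => w aw; apply.
Qed.

(** The threshold of each point is selected measurably and becomes [n0]. With two indices the
    statement serves Cauchy conditions, and convergence when [P] ignores the second. *)
Lemma threshold_exists (P : nat -> nat -> set T) :
  (forall k l, measurable (P k l)) ->
  (\forall w \ae mu,
    exists N, forall k l, (N <= k)%N -> (N <= l)%N -> P k l w) ->
  exists n0 : condnat mu, forall m n : condnat mu,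
    condnat_le n0 m -> condnat_le n0 n ->
    \forall w \ae mu, P (step_rep m w) (step_rep n w) w.
Proof.
move=> mP eP.
pose Q N := \bigcap_(k in [set k | (N <= k)%N])
  \bigcap_(l in [set l | (N <= l)%N]) P k l.
have mQ N : measurable (Q N).
  by apply: bigcap_measurableType => k _; apply: bigcap_measurableType.
have eQ : \forall w \ae mu, exists N, Q N w.
  by apply: filterS eP => w [N PN]; exists N => k Nk l Nl; exact: PN.
have [h ch hQ] := ae_measurable_select mu_complete mQ eQ.
exists (step_fun h) => m n /condnat_leP hm /condnat_leP hn.
have hE := step_funE ch.
apply: filter_app hm; apply: filter_app hn; apply: filterS2 hE hQ => w -> Qw ?
  ?.
exact: Qw.
Qed.

Lemma threshold_pointwise (P : nat -> nat -> set T) (n0 : condnat mu) :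
  (forall m n : condnat mu, condnat_le n0 m -> condnat_le n0 n ->
    \forall w \ae mu, P (step_rep m w) (step_rep n w) w) ->
  \forall w \ae mu, exists N, forall k l, (N <= k)%N -> (N <= l)%N -> P k l w.
Proof.
(* m k dominates n0 and takes the value k wherever n0 <= k. *)
move=> n0P; pose m k : condnat mu := step_fun (fun w => maxn k (step_rep n0 w)).
have mE k : \forall w \ae mu, step_rep (m k) w = maxn k (step_rep n0 w).
  by apply: step_funE; apply: countably_valued_comp (step_rep_cv _).
have n0m k : condnat_le n0 (m k).
  by apply/condnat_leP; apply: filterS (mE k) => w ->; exact: leq_maxr.
have : \forall w \ae mu, forall k l, P (maxn k (step_rep n0 w))
  (maxn l (step_rep n0 w)) w.
  apply: ae_foralln => k; apply: ae_foralln => l.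
  by apply: filterS3 (mE k) (mE l) (n0P _ _ (n0m k) (n0m l)) => w -> ->.
apply: filterS => w Pw; exists (step_rep n0 w) =>
  k l /maxn_idPl kE /maxn_idPl lE.
by have := Pw k l; rewrite kE lE.
Qed.

(** [n] is the concatenation of the constants [k] along its own level sets, and stability carries
    this over to [x n]. *)
Lemma stable_seqE (E : condset mu) (V : Type) (rho : E -> T -> V)
    (x : condnat mu -> E) : realized rho -> stable x ->
  forall n : condnat mu, \forall w \ae mu,
    rho (x n) w = rho (x (step_cst mu (step_rep n w))) w.
Proof.
move=> rhoP sx n; apply: (ae_fibers (step_rep_cv n)) => k.
have /(is_concatP _ _ _ rhoP)/(_ k) : is_concat (step_at (n : step mu nat))
    (fun k => x (step_cst mu k)) (x n).
  apply: sx; first exact: step_partition.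
  apply/(is_concatP _ _ _ (@step_realized nat)) => i.
  by apply: filterS2 (step_repP n i) (step_rep_cst i) => w ni -> /ni.
by apply: filterS2 (step_repP n k) => w nk h /[dup] /nk/h + -> => ->.
Qed.

(** * Measurable functions up to null sets *)

Lemma class_agreeP (V : Type) (a : malg mu) (f g : T -> V) :
  (exists2 B : measset T, malg_class mu B = a & ae_eq mu (B : set T) f g) <->
  \forall w \ae mu, malg_set a w -> f w = g w.
Proof.
split=> [[B <-]|fg]; last by exists (repr a); first exact: malg_setK.
by apply: filterS2 (malg_set_class mu B) => w BE fg /BE/fg.
Qed.

Lemma L0_measurable (f : L0 mu) : measurable_fun setT (f : T -> R).
Proof. exact: (@measurable_funPT _ _ _ _ (repr f :
  {mfun T >-> measurableTypeR R})). Qed.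

Lemma L0_ofE (f : T -> R) : measurable_fun setT f ->
  \forall w \ae mu, L0_of mu f w = f w.
Proof.
move=> mf; pose y : {mfun T >-> measurableTypeR R} :=
  insubd (cst 0 : {mfun T >-> measurableTypeR R}) f.
have yE : (y : T -> R) = f by rewrite /y insubdK// inE.
have : repr (\pi_(L0 mu) y)%qT = y %[mod L0 mu]%qT by rewrite reprK.
move=> /eqP; rewrite eqmodE => /asboolP.
by apply: filterS => w /(_ I) h; rewrite -{2}yE -h.
Qed.

Lemma L0_eqP (f g : L0 mu) : f = g <-> \forall w \ae mu, f w = g w.
Proof.
split=> [->|fg]; first exact: aeW.
rewrite -(reprK f) -(reprK g); apply/eqP; rewrite eqmodE; apply/asboolP.
by apply: filterS fg => w.
Qed.

Lemma L0_realized : @realized _ _ _ mu (condL0 mu) _ (@L0_fun _ _ _ mu).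
Proof. by apply: realized_of => a f g; exact: class_agreeP. Qed.

Lemma L0_addE (f g : L0 mu) : \forall w \ae mu, L0_add f g w = f w + g w.
Proof. by apply: L0_ofE; apply: measurable_funD; exact: L0_measurable. Qed.

Lemma L0_subE (f g : L0 mu) : \forall w \ae mu, L0_sub f g w = f w - g w.
Proof. by apply: L0_ofE; apply: measurable_funB; exact: L0_measurable. Qed.

Lemma L0_mulE (f g : L0 mu) : \forall w \ae mu, L0_mul f g w = f w * g w.
Proof. by apply: L0_ofE; apply: measurable_funM; exact: L0_measurable. Qed.

Lemma L0_absE (f : L0 mu) : \forall w \ae mu, L0_abs f w = `|f w|.
Proof. by apply: L0_ofE; apply: measurableT_comp => //;
  exact: L0_measurable. Qed.

Lemma L0_cstE (c : R) : \forall w \ae mu, L0_of mu (fun=> c) w = c.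
Proof. by apply: L0_ofE; exact: measurable_cst. Qed.

(** * The Bochner space *)

Section bochner_space.
Variable X : completeNormedModType R.
Local Notation L0X := (L0X mu X).
Implicit Types (x y : L0X).

Lemma L0X_measurable x : strongly_measurable mu (x : T -> X).
Proof. exact: set_mem (valP (repr x)). Qed.

Lemma L0X_of_aeE (f : T -> X) : strongly_measurable mu f ->
  \forall w \ae mu, L0X_of mu f w = f w.
Proof. by move=> /(@L0X_ofE _ _ _ mu); apply: filterS => w; apply. Qed.

Lemma L0X_eqP x y : x = y <-> \forall w \ae mu, x w = y w.
Proof.
split=> [->|xy]; first exact: aeW.
rewrite -(reprK x) -(reprK y); apply/eqP; rewrite eqmodE; apply/asboolP.
by apply: filterS xy => w.
Qed.

Lemma L0X_realized : @realized _ _ _ mu (bochner mu X) _ (@L0X_fun _ _ _ mu X).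
Proof. by apply: realized_of => a f g; exact: class_agreeP. Qed.

Lemma L0X_zeroE : \forall w \ae mu, L0X_zero mu X w = 0.
Proof. by apply: L0X_of_aeE; exact: strongly_measurable_cst. Qed.

Lemma L0X_oppE x : \forall w \ae mu, L0X_opp x w = - x w.
Proof.
apply: L0X_of_aeE.
apply: (strongly_measurable_comp2 (F := fun u _ : X => - u) mu_complete _
  (L0X_measurable x) (L0X_measurable x)) => u v a b ua _.
exact: cvgN.
Qed.

Lemma L0X_addE x y : \forall w \ae mu, L0X_add x y w = x w + y w.
Proof.
apply: L0X_of_aeE.
apply: (strongly_measurable_comp2 (F := fun u v : X => u + v) mu_complete _
  (L0X_measurable x) (L0X_measurable y)) => u v a b.
exact: cvgD.
Qed.

Lemma L0X_scaleE (r : L0 mu) x : \forall w \ae mu, L0X_scale r x w = r w *: x w.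
Proof.
apply: L0X_of_aeE.
apply: (strongly_measurable_comp2 (X := R^o)
  (F := fun (t : R^o) (u : X) => (t : R) *: u)
  mu_complete _ (measurable_strongly_measurable mu (L0_measurable r))
    (L0X_measurable x)).
move=> u v a b; exact: cvgZ.
Qed.

Lemma L0X_normE x : \forall w \ae mu, L0X_norm x w = `|x w|.
Proof. by apply: L0_ofE; exact: measurable_norm (L0X_measurable x). Qed.

Lemma bochner_distE x y : \forall w \ae mu,
  @cn_dist _ _ _ _ (bochner mu X) x y w = `|x w - y w|.
Proof.
apply: filterS3 (L0X_normE (L0X_add x (L0X_opp y))) (L0X_addE x (L0X_opp y))
  (L0X_oppE y) => w.
by rewrite /cn_dist /= => -> -> ->.
Qed.

Lemma bochner_vector_space : is_cond_vector_space (bochner mu X).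
Proof.
split.
- apply: (realized_condset L0X_realized); first exact: inhabits (L0X_zero mu X).
    by move=> x y /L0X_eqP.
  move=> I h x_ ch; exists (L0X_of mu (fun w => (x_ (h w) : L0X) w)).
  apply: L0X_of_aeE; apply: (strongly_measurable_glue mu_complete (x :=
    fun i => (x_ i : L0X) : T -> X) ch).
  by move=> i; exact: L0X_measurable.
- move=> x y z; apply/L0X_eqP.
  apply: filter_app (L0X_addE x (L0X_add y z)).
  apply: filter_app (L0X_addE (L0X_add x y) z).
  apply: filterS2 (L0X_addE x y) (L0X_addE y z) => w xy yz xyz xyz'.
  by rewrite /= xyz xyz' xy yz addrA.
- move=> x y; apply/L0X_eqP; apply: filterS2 (L0X_addE x y) (L0X_addE y x).
  by move=> w xy yx; rewrite /= xy yx addrC.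
- move=> x; apply/L0X_eqP.
  apply: filterS2 (L0X_addE (L0X_zero mu X) x) L0X_zeroE => w h z.
  by rewrite /= h z add0r.
- move=> x; apply/L0X_eqP.
  apply: filterS3 (L0X_addE (L0X_opp x) x) (L0X_oppE x) L0X_zeroE => w h o z.
  by rewrite /= h o z addNr.
- move=> r s x; apply/L0X_eqP; apply: filter_app (L0X_scaleE r (L0X_scale s x)).
  apply: filter_app (L0X_scaleE (L0_mul r s) x).
  apply: filterS2 (L0X_scaleE s x) (L0_mulE r s) => w sx rs rsx rsx'.
  by rewrite /= rsx rsx' sx rs scalerA.
- move=> x; apply/L0X_eqP.
  by apply: filterS2 (L0X_scaleE (L0_1 mu) x) (L0_cstE 1) => w -> ->;
    rewrite scale1r.
- move=> r x y; apply/L0X_eqP; apply: filter_app (L0X_scaleE r (L0X_add x y)).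
  apply: filter_app (L0X_addE (L0X_scale r x) (L0X_scale r y)).
  apply: filterS3 (L0X_scaleE r x) (L0X_scaleE r y) (L0X_addE x y).
  by move=> w rx ry xy s1 s2; rewrite /= s1 s2 rx ry xy scalerDr.
- move=> r s x; apply/L0X_eqP; apply: filter_app (L0X_scaleE (L0_add r s) x).
  apply: filter_app (L0X_addE (L0X_scale r x) (L0X_scale s x)).
  apply: filterS3 (L0X_scaleE r x) (L0X_scaleE s x) (L0_addE r s).
  by move=> w rx sx rs s1 s2; rewrite /= s1 s2 rx sx rs scalerDl.
- apply: (stable_pointwise (Phi := fun _ p => p.1 + p.2)
    (realized_prod L0X_realized L0X_realized) L0X_realized) => -[x y] /=.
  exact: L0X_addE.
- apply: (stable_pointwise (Phi := fun _ p => p.1 *: p.2)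
    (realized_prod L0_realized L0X_realized) L0X_realized) => -[r x] /=.
  exact: L0X_scaleE.
Qed.

Lemma bochner_norm : is_cond_norm (bochner mu X).
Proof.
split.
- apply: (stable_pointwise (Phi := fun _ u => `|u|) L0X_realized L0_realized).
  exact: L0X_normE.
- move=> x; apply: filterS2 (L0X_normE x) (L0_cstE 0) => w xE zE.
  by rewrite /= xE zE.
- move=> x; split=> [/L0_eqP x0|->].
    apply/L0X_eqP; apply: filter_app x0.
    apply: filterS3 (L0X_normE x) (L0_cstE 0) L0X_zeroE => w xE zE z.
    by rewrite /= xE zE z => /normr0_eq0.
  apply/L0_eqP; apply: filterS3 (L0X_normE (L0X_zero mu X)) (L0_cstE 0)
    L0X_zeroE.
  by move=> w xE zE z; rewrite /= xE zE z normr0.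
- move=> r x; apply/L0_eqP; apply: filter_app (L0X_normE (L0X_scale r x)).
  apply: filter_app (L0_mulE (L0_abs r) (L0X_norm x)).
  apply: filterS3 (L0X_scaleE r x) (L0_absE r) (L0X_normE x).
  by move=> w rx ra xE s1 s2; rewrite /= s1 s2 rx ra xE normrZ.
- move=> x y; apply: filter_app (L0X_normE (L0X_add x y)).
  apply: filter_app (L0_addE (L0X_norm x) (L0X_norm y)).
  apply: filterS3 (L0X_addE x y) (L0X_normE x) (L0X_normE y).
  by move=> w xy xE yE s1 s2; rewrite /= s1 s2 xy xE yE ler_normD.
Qed.

Lemma bochner_complete (x : condnat mu -> bochner mu X) :
  stable x -> cond_cauchy x -> exists l, cond_limit x l.
Proof.
move=> sx cx; pose u k : L0X := x (step_cst mu k).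
have uE (n : condnat mu) : \forall w \ae mu, (x n : L0X) w = u (step_rep n w) w.
  exact: (stable_seqE L0X_realized sx).
have u_cauchy : \forall w \ae mu, forall j : nat, exists N, forall k l,
    (N <= k)%N -> (N <= l)%N -> `|u k w - u l w| < j.+1%:R^-1.
  apply: ae_foralln => j.
  (* The radii $1/(j+1)$ are countably many, so a single null set serves for all of them. *)
  have [|n0 n0P] := cx (L0_of mu (fun=> j.+1%:R^-1)).
    by apply: filterS2 (L0_cstE 0) (L0_cstE j.+1%:R^-1) => w -> ->;
      exact: invS_gt0.
  apply: (@threshold_pointwise (fun k l => [set w | `|u k w - u l w| <
    j.+1%:R^-1]) n0).
  move=> m n n0m n0n; apply: filter_app (n0P _ _ n0m n0n).
  apply: filter_app (bochner_distE (x m) (x n)).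
  apply: filterS3 (L0_cstE j.+1%:R^-1) (uE m) (uE n) => w c um un xmn.
  by rewrite xmn c um un.
have u_cvg : \forall w \ae mu,
    (fun k => u k w) @ \oo --> lim ((fun k => u k w) @ \oo).
  by apply: filterS u_cauchy => w /seq_cauchy_cvg.
pose l := L0X_of mu (fun w => lim ((fun k => u k w) @ \oo)).
have lE : \forall w \ae mu, l w = lim ((fun k => u k w) @ \oo).
  apply: L0X_of_aeE; apply: (strongly_measurable_lim mu_complete) u_cvg => k.
  exact: L0X_measurable.
exists l => r r0.
(* As elements of $L^0$ the distances are measurable, and so is the set where they fall below the
   variable radius [r]. *)
pose delta k : L0 mu := @cn_dist _ _ _ _ (bochner mu X) (u k) l.
have dE : \forall w \ae mu, forall k, delta k w = `|u k w - l w|.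
  by apply: ae_foralln => k; exact: bochner_distE.
have [k _||n0 n0P] := @threshold_exists (fun k _ => [set w | delta k w < r w]).
- rewrite -[X in measurable X]setTI.
  by apply: (measurable_fun_ltr (L0_measurable (delta k)) (L0_measurable r)
    measurableT (Y := [set true])).
- apply: filter_app dE; apply: filter_app (L0_cstE 0); apply: filter_app r0.
  apply: filterS2 u_cvg lE => w uw lw rw z dw.
  have [|N hN] := (seq_cvgP _ _).1 uw (r w); first by rewrite -z.
  exists N => k _ Nk _ /=; rewrite dw distrC lw; exact: hN.
exists n0 => n n0n; apply: filter_app (n0P _ _ n0n n0n).
apply: filter_app (bochner_distE (x n) l).
by apply: filterS2 dE (uE n) => w dw un xn; rewrite /= dw xn un.
Qed.

Lemma bochner_banach : is_cond_banach (bochner mu X).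
Proof. split; [exact: bochner_vector_space|exact: bochner_norm|exact:
  bochner_complete]. Qed.

End bochner_space.

(** * The conditional completion *)

Section step_sequences.
Variable E : pointedType.
Implicit Types x : condnat mu -> condstep mu E.

Definition seq_rep x (k : nat) : T -> E := step_rep (x (step_cst mu k)).

Lemma seq_repE x (n : condnat mu) : stable x ->
  \forall w \ae mu, step_rep (x n) w = seq_rep x (step_rep n w) w.
Proof. by move=> sx; exact: (stable_seqE (@step_realized E) sx). Qed.

(** Converse of [seq_repE]: a sequence given by a pointwise formula is stable, and its values at the
    constants give the formula back. *)
Lemma stable_seq x (f : nat -> T -> E) :
  (forall n, \forall w \ae mu, step_rep (x n) w = f (step_rep n w) w) ->
  stable x /\ \forall w \ae mu, forall k, seq_rep x k w = f k w.
Proof.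
move=> xf; split.
  by apply: (stable_pointwise (Phi := fun w k => f k w)
    (@step_realized nat) (@step_realized E)).
apply: ae_foralln => k.
by apply: filterS2 (xf (step_cst mu k)) (step_rep_cst k) => w xw kw;
  rewrite /seq_rep xw kw.
Qed.

End step_sequences.

Lemma step_posP (r : step mu R) :
  step_pos r <-> \forall w \ae mu, 0 < step_rep r w.
Proof.
rewrite /step_pos /step_lt_on; apply: (iff_trans (step_relP _ _ _ _)).
split; apply: filterS3 (malg_setT mu) (step_rep_cst (0 : R)) => w aw ->.
  exact.
by [].
Qed.

Section step_limits.
Variable X : completeNormedModType R.
Implicit Types x y : condnat mu -> condstep mu X.

Definition seq_lim x (w : T) : X := lim ((fun k => seq_rep x k w) @ \oo).

Lemma step_distE (f g : step mu X) : \forall w \ae mu,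
  step_rep (step_dist f g) w = `|step_rep f w - step_rep g w|.
Proof.
set fg := step_map2 (fun u v : X => u - v) f g.
have fgE := step_rep_map2 (fun u v : X => u - v) f g.
apply: filterS2 (step_rep_map (fun v : X => `|v|) fg) fgE => w.
by rewrite /step_dist => -> ->.
Qed.

Lemma step_dist_ltP (a : malg mu) (f g : step mu X) (r : step mu R) :
  step_lt_on a (step_dist f g) r <-> \forall w \ae mu,
    malg_set a w -> `|step_rep f w - step_rep g w| < step_rep r w.
Proof.
apply: (iff_trans (step_relP _ _ _ _)).
by split; apply: filterS2 (step_distE f g) => w ->.
Qed.

Lemma cauchy_seqsP x : cauchy_seqs x <->
  stable x /\ \forall w \ae mu, cvg ((fun k => seq_rep x k w) @ \oo).
Proof.
split=> -[sx cx]; split=> //.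
  have : \forall w \ae mu, forall j : nat, exists N, forall k l,
      (N <= k)%N -> (N <= l)%N -> `|seq_rep x k w - seq_rep x l w| < j.+1%:R^-1.
    apply: ae_foralln => j.
    have [|n0 n0P] := cx (step_cst mu (j.+1%:R^-1 : R)).
      by apply/step_posP; apply: filterS (step_rep_cst (j.+1%:R^-1 : R)) =>
        w ->; exact: invS_gt0.
    apply: (@threshold_pointwise
      (fun k l => [set w | `|seq_rep x k w - seq_rep x l w| < j.+1%:R^-1]) n0).
    move=> m n n0m n0n; have /step_dist_ltP := n0P _ _ n0m n0n;
      apply: filter_app.
    apply: filter_app (malg_setT mu).
    apply: filterS3 (step_rep_cst (j.+1%:R^-1 : R)) (seq_repE m sx)
      (seq_repE n sx).
    by move=> w -> -> -> aw /(_ aw).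
  by apply: filterS => w /seq_cauchy_cvg.
move=> r /step_posP r0.
have [k l||n0 n0P] := @threshold_exists
  (fun k l => [set w | `|seq_rep x k w - seq_rep x l w| < step_rep r w]).
- have := countably_valued_comp2 (fun (s t : R) => s < t)
    (countably_valued_comp2 (fun u v : X => `|u - v|)
      (step_rep_cv (x (step_cst mu k))) (step_rep_cv (x (step_cst mu l))))
    (step_rep_cv r).
  by move=> [_ /(_ true)].
- apply: filterS2 cx r0 => w cx r0.
  by have [N hN] := seq_cvg_cauchy cx r0; exists N => k l; exact: hN.
exists n0 => m n n0m n0n; apply/step_dist_ltP;
  apply: filter_app (n0P _ _ n0m n0n).
by apply: filterS2 (seq_repE m sx) (seq_repE n sx) => w -> ->.
Qed.

Lemma seq_lim_cvg x : cauchy_seqs x ->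
  \forall w \ae mu, (fun k => seq_rep x k w) @ \oo --> seq_lim x w.
Proof. by move=> /cauchy_seqsP[_]. Qed.

Lemma seqs_agreeP (a : malg mu) x y : cauchy_seqs x -> cauchy_seqs y ->
  seqs_agree a x y <->
  \forall w \ae mu, malg_set a w -> seq_lim x w = seq_lim y w.
Proof.
move=> cx cy; have [[sx _] [sy _]] := (cx, cy).
split=> xy.
  have : \forall w \ae mu, forall j : nat, exists N, forall k l : nat,
      (N <= k)%N -> (N <= l)%N ->
      malg_set a w -> `|seq_rep x k w - seq_rep y k w| < j.+1%:R^-1.
    apply: ae_foralln => j.
    have [|n0 n0P] := xy (step_cst mu (j.+1%:R^-1 : R)).
      by apply/step_posP; apply: filterS (step_rep_cst (j.+1%:R^-1 : R)) =>
        w ->; exact: invS_gt0.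
    apply: (@threshold_pointwise
      (* Thresholds live on all of [T], so the restriction to [a] is moved into the set as a
         premise. *)
      (fun k _ => [set w | malg_set a w -> `|seq_rep x k w - seq_rep y k w| <
        j.+1%:R^-1]) n0).
    move=> m n n0m _; have /step_dist_ltP := n0P _ n0m; apply: filter_app.
    by apply: filterS3 (step_rep_cst (j.+1%:R^-1 : R)) (seq_repE m sx)
      (seq_repE m sy) => w -> -> ->.
  apply: filterS3 (seq_lim_cvg cx) (seq_lim_cvg cy) => w xw yw h aw.
  have d0 : (fun k => seq_rep x k w - seq_rep y k w) @ \oo --> (0 : X).
    apply: seq_cvg_invS => j; have [N hN] := h j.
    by exists N => k Nk; rewrite sub0r normrN; exact: (hN k k Nk Nk aw).
  have d1 : (fun k => seq_rep x k w - seq_rep y k w) @ \oo --> seq_lim x w -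
    seq_lim y w.
    exact: cvgB.
  by apply/eqP; rewrite -subr_eq0; apply/eqP; exact: norm_cvg_unique d1 d0.
move=> r /step_posP r0.
have [k l||n0 n0P] := @threshold_exists
  (fun k _ => [set w | malg_set a w -> `|seq_rep x k w - seq_rep y k w| <
    step_rep r w]).
- have := countably_valued_comp2 (fun (s t : R) => s < t)
    (countably_valued_comp2 (fun u v : X => `|u - v|)
      (step_rep_cv (x (step_cst mu k))) (step_rep_cv (y (step_cst mu k))))
    (step_rep_cv r).
  move=> [_ /(_ true)] mlt.
  rewrite [X in measurable X](_ : _ = ~` malg_set a `|`
    [set w | `|seq_rep x k w - seq_rep y k w| < step_rep r w]).
    by apply: measurableU => //; apply: measurableC; exact: malg_set_measurable.
  apply/seteqP; split=> w /= h; last by case: h.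
  by have [aw|aw] := pselect (malg_set a w); [right; exact: h|left].
- apply: filter_app r0; apply: filterS3 (seq_lim_cvg cx) (seq_lim_cvg cy) xy.
  move=> w xw yw xyw r0; have [aw|aw] := pselect (malg_set a w); last first.
    (* Outside [a] nothing is required, and any threshold does. *)
    by exists 0%N => k l _ _ /= /aw.
  have d0 : (fun k => seq_rep x k w - seq_rep y k w) @ \oo -->
      seq_lim x w - seq_lim y w by exact: cvgB.
  rewrite (xyw aw) subrr in d0.
  have [N hN] := (seq_cvgP _ _).1 d0 _ r0; exists N => k _ Nk _ _.
  by have := hN k Nk; rewrite sub0r normrN.
exists n0 => m n0m; apply/step_dist_ltP; apply: filter_app (n0P _ _ n0m n0m).
by apply: filterS2 (seq_repE m sx) (seq_repE m sy) => w -> ->.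
Qed.

Lemma cauchy_seq_lim x (f : nat -> T -> X) (g : T -> X) :
  (forall n, \forall w \ae mu, step_rep (x n) w = f (step_rep n w) w) ->
  (\forall w \ae mu, (fun k => f k w) @ \oo --> g w) ->
  cauchy_seqs x /\ \forall w \ae mu, seq_lim x w = g w.
Proof.
move=> /stable_seq[sx xf] fg.
have xg : \forall w \ae mu, (fun k => seq_rep x k w) @ \oo --> g w.
  by apply: filterS2 xf fg => w /funext ->.
split; last by apply: filterS xg => w /norm_cvg_lim.
by apply/cauchy_seqsP; split=> //; apply: filterS xg => w /cvgP.
Qed.

Lemma seq_lim_measurable x : cauchy_seqs x -> strongly_measurable mu
  (seq_lim x).
Proof.
move=> cx; apply/(strongly_measurableP mu_complete).
by exists (seq_rep x); [move=> k; exact: step_rep_cv|exact: seq_lim_cvg].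
Qed.

Lemma cauchy_seq_exists (g : T -> X) : strongly_measurable mu g ->
  exists x, cauchy_seqs x /\ \forall w \ae mu, seq_lim x w = g w.
Proof.
move=> /(strongly_measurableP mu_complete)[c cc cg].
(* Up to null sets this is the only stable sequence with value [c k] at the constant [k]. *)
exists (fun n => step_fun (fun w => c (step_rep n w) w)).
apply: (cauchy_seq_lim (f := c)) => // n.
by apply: step_funE; apply: countably_valued_diag (step_rep_cv n) cc.
Qed.

Implicit Types c : Xc mu X.

Definition Xc_lim c : T -> X := seq_lim (Xc_repr c).

Lemma Xc_repr_cauchy c : cauchy_seqs (Xc_repr c).
Proof. by rewrite /Xc_repr; case: cid2. Qed.

Lemma Xc_repr_class c : cauchy_class (Xc_repr c) = val c.
Proof. by rewrite /Xc_repr; case: cid2. Qed.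

Lemma Xc_agreeP (a : malg mu) c c' : Xc_agree a c c' <->
  \forall w \ae mu, malg_set a w -> Xc_lim c w = Xc_lim c' w.
Proof. by apply: seqs_agreeP; exact: Xc_repr_cauchy. Qed.

Lemma Xc_realized : @realized _ _ _ mu (completion mu X) _ Xc_lim.
Proof. by apply: realized_of => a f g; exact: Xc_agreeP. Qed.

Lemma Xc_lim_measurable c : strongly_measurable mu (Xc_lim c).
Proof. by apply: seq_lim_measurable; exact: Xc_repr_cauchy. Qed.

Lemma Xc_ofE x : cauchy_seqs x ->
  \forall w \ae mu, Xc_lim (Xc_of x) w = seq_lim x w.
Proof.
move=> cx; have cr := Xc_repr_cauchy (Xc_of x).
(* The chosen representative belongs to its own class, which is that of [x]; hence both have the
   same limit. *)
have : cauchy_class x (Xc_repr (Xc_of x)).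
  have <- : val (Xc_of x) = cauchy_class x.
    by rewrite /Xc_of insubdK//; exact: mem_set (imageP _ cx).
  rewrite -Xc_repr_class; split=> //; apply/(seqs_agreeP _ cr cr); exact: aeW.
move=> [_ /(seqs_agreeP _ cx cr)].
by apply: filterS2 (malg_setT mu) => w aw /(_ aw).
Qed.

Lemma Xc_eqP c c' : c = c' <-> \forall w \ae mu, Xc_lim c w = Xc_lim c' w.
Proof.
split=> [->|cc']; first exact: aeW.
apply: val_inj; rewrite -!Xc_repr_class.
have [rc rc'] := (Xc_repr_cauchy c, Xc_repr_cauchy c').
apply/seteqP; split=> x [cx /(seqs_agreeP _ _ cx) h]; split=> //;
  apply/seqs_agreeP => //.
  by apply: filterS2 cc' (h rc) => w e f /f <-; rewrite -/(Xc_lim c' w) -e.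
by apply: filterS2 cc' (h rc') => w e f /f <-; rewrite -/(Xc_lim c w) e.
Qed.

End step_limits.

(** * Conditional real numbers and their limits in $L^0$ *)

Lemma L0_of_stepE (f : step mu R) :
  \forall w \ae mu, L0_of_step f w = step_rep f w.
Proof.
pose S := [set g : L0 mu |
  is_concat f (fun v : R => L0_of mu (fun=> v) : condL0 mu) g].
have SP g : S g <-> forall v, \forall w \ae mu, malg_set (f v) w -> g w = v.
  apply: (iff_trans (is_concatP _ _ _ L0_realized)).
  split=> h v; apply: filterS2 (h v) (L0_cstE v) => w gv vE aw.
    exact: etrans (gv aw) vE.
  exact: etrans (gv aw) (esym vE).
have Sg : S (L0_of mu (step_rep f)).
  apply/SP => v; apply: filterS2 (step_repP f v) (L0_ofE _) => [w fv ->|].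
    by move=> /fv.
  exact: countably_valued_measurable (step_rep_cv f).
have /SP h : S (L0_of_step f) by exact: xgetPex (ex_intro _ _ Sg).
apply: (ae_fibers (step_rep_cv f)) => v.
by apply: filterS2 (step_repP f v) (h v) => w fv gv wv; rewrite wv; exact/gv/fv.
Qed.

(** Since [L0_lim] is obtained by choice, two facts are needed: the class of [g] satisfies its
    defining condition, and whatever satisfies it is a pointwise limit, hence equals [g] almost
    everywhere. *)
Lemma L0_limE (r : condnat mu -> step mu R) (g : T -> R) :
  stable (r : condnat mu -> condstep mu R) ->
  (\forall w \ae mu,
    (fun k => seq_rep (r : condnat mu -> condstep mu R) k w) @ \oo --> g w) ->
  \forall w \ae mu, L0_lim r w = g w.
Proof.
move=> sr rg; pose u := seq_rep (r : condnat mu -> condstep mu R).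
pose S := [set g : L0 mu | forall e : L0 mu, L0_lt (L0_0 mu) e ->
  exists n0 : condnat mu, forall n, condnat_le n0 n ->
  L0_lt (L0_abs (L0_sub (L0_of_step (r n)) g)) e].
have distE (n : condnat mu) (g' : L0 mu) : \forall w \ae mu,
    L0_abs (L0_sub (L0_of_step (r n)) g') w = `|u (step_rep n w) w - g' w|.
  apply: filter_app (L0_absE (L0_sub (L0_of_step (r n)) g')).
  apply: filterS3 (L0_subE (L0_of_step (r n)) g') (L0_of_stepE (r n))
    (seq_repE n sr).
  by move=> w h1 h2 h3 h4; rewrite h4 h1 h2 h3.
have mg : measurable_fun setT g.
  apply: (ae_cvg_measurable mu_complete (f := u)) rg => k.
  by apply: countably_valued_measurable; exact: step_rep_cv.
have Sg : S (L0_of mu g).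
  move=> e e0.
  have [k _||n0 n0P] := @threshold_exists (fun k _ =>
    [set w | `|u k w - L0_of mu g w| < e w]).
  - rewrite -[X in measurable X]setTI.
    apply: (measurable_fun_ltr _ (L0_measurable e) measurableT (Y :=
      [set true])) => //.
    apply: measurableT_comp => //; apply: measurable_funB (L0_measurable _).
    by apply: countably_valued_measurable; exact: step_rep_cv.
  - apply: filter_app (L0_ofE mg); apply: filterS3 rg e0 (L0_cstE 0) => w rg e0
      z gE.
    rewrite z in e0; have [N hN] := (seq_cvgP (X := R^o) _ _).1 rg _ e0.
    by exists N => k _ Nk _ /=; rewrite gE distrC; exact: hN.
  exists n0 => n n0n; apply: filter_app (n0P _ _ n0n n0n).
  by apply: filterS (distE n (L0_of mu g)) => w ->.
have Sl : S (L0_lim r) by exact: xgetPex (ex_intro _ _ Sg).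
have : \forall w \ae mu, forall j : nat, exists N, forall k l : nat,
    (N <= k)%N -> (N <= l)%N -> `|u k w - L0_lim r w| < j.+1%:R^-1.
  apply: ae_foralln => j.
  have [|n0 n0P] := Sl (L0_of mu (fun=> j.+1%:R^-1)).
    by apply: filterS2 (L0_cstE 0) (L0_cstE j.+1%:R^-1) => w -> ->;
      exact: invS_gt0.
  apply: (@threshold_pointwise (fun k _ => [set w | `|u k w - L0_lim r w| <
    j.+1%:R^-1]) n0).
  move=> m n n0m _; apply: filter_app (n0P _ n0m).
  by apply: filterS2 (distE m (L0_lim r)) (L0_cstE j.+1%:R^-1) => w -> ->.
apply: filterS2 rg => w rg h.
apply: (@norm_cvg_unique _ R^o _ _ _ _ _ rg).
apply: seq_cvg_invS => j; have [N hN] := h j.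
by exists N => k Nk; rewrite distrC; exact: (hN k k).
Qed.

Lemma L0_of_realE (c : cond_real mu) :
  \forall w \ae mu, L0_of_real c w = Xc_lim c w.
Proof.
have cr := Xc_repr_cauchy c.
by apply: L0_limE; [exact: cr.1|exact: seq_lim_cvg cr].
Qed.

(** Each [r] is the limit of a conditional Cauchy sequence in $\mathbb{R}_s$, so the identification
    of [cond_real] with $L^0$ is onto and the choice in [real_of_L0] succeeds. *)
Lemma real_of_L0E (r : L0 mu) : \forall w \ae mu, Xc_lim (real_of_L0 r) w = r w.
Proof.
have [x [cx xr]] := cauchy_seq_exists (X := R^o)
  (measurable_strongly_measurable mu (L0_measurable r)).
have xrE : L0_of_real (Xc_of x) = r.
  apply/L0_eqP; apply: filterS3 (L0_of_realE (Xc_of x)) (Xc_ofE cx) xr.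
  by move=> w -> ->.
have rE : L0_of_real (real_of_L0 r) = r.
  exact: (xgetPex (P := [set c | L0_of_real c = r]) _ (ex_intro _ _ xrE)).
by apply: filterS (L0_of_realE (real_of_L0 r)) => w <-; rewrite rE.
Qed.

(** * Operations of the completion, computed on limits *)

Section completion_operations.
Variable X : completeNormedModType R.
Implicit Types c : Xc mu X.

(** Sequential continuity of [h] lets limits be taken termwise. The factors differ because scaling
    pairs [R^o] with [X]. *)
Lemma Xc_comp2E (Y Z : completeNormedModType R) (h : Y -> Z -> X)
    (a : Xc mu Y) (b : Xc mu Z) :
  (forall (u : nat -> Y) (v : nat -> Z) p q, u @ \oo --> p -> v @ \oo --> q ->
    (fun n => h (u n) (v n)) @ \oo --> h p q) ->
  \forall w \ae mu,
    Xc_lim (Xc_of (fun n => step_map2 h (Xc_repr a n) (Xc_repr b n))) w =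
    h (Xc_lim a w) (Xc_lim b w).
Proof.
move=> h_cvg; have [ca cb] := (Xc_repr_cauchy a, Xc_repr_cauchy b).
have [cx xE] : cauchy_seqs (fun n => step_map2 h (Xc_repr a n) (Xc_repr b n)) /\
    \forall w \ae mu, seq_lim (fun n => step_map2 h (Xc_repr a n)
      (Xc_repr b n)) w =
      h (Xc_lim a w) (Xc_lim b w).
  apply: (cauchy_seq_lim (f := fun k w =>
    h (seq_rep (Xc_repr a) k w) (seq_rep (Xc_repr b) k w))) => [n|].
    apply: filterS3 (step_rep_map2 h (Xc_repr a n) (Xc_repr b n))
      (seq_repE n ca.1) (seq_repE n cb.1).
    by move=> w -> -> ->.
  by apply: filterS2 (seq_lim_cvg ca) (seq_lim_cvg cb) => w; exact: h_cvg.
by apply: filterS2 (Xc_ofE cx) xE => w -> ->.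
Qed.

Lemma Xc_addE c c' :
  \forall w \ae mu, Xc_lim (Xc_add c c') w = Xc_lim c w + Xc_lim c' w.
Proof. by apply: Xc_comp2E => u v p q; exact: cvgD. Qed.

Lemma Xc_scaleE (r : L0 mu) c :
  \forall w \ae mu, Xc_lim (Xc_scale r c) w = r w *: Xc_lim c w.
Proof.
have scale_cvg (u : nat -> R^o) (v : nat -> X) p q :
    u @ \oo --> p -> v @ \oo --> q ->
    (fun n => (u n : R) *: v n) @ \oo --> (p : R) *: q.
  exact: cvgZ.
have h := Xc_comp2E (real_of_L0 r) c scale_cvg.
by apply: filterS2 h (real_of_L0E r) => w + <-.
Qed.

Lemma Xc_normE c : \forall w \ae mu, Xc_norm c w = `|Xc_lim c w|.
Proof.
have cc := Xc_repr_cauchy c.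
pose y (n : condnat mu) : condstep mu R :=
  step_map (fun u : X => `|u|) (Xc_repr c n).
have [sy yE] : stable y /\
    \forall w \ae mu, forall k, seq_rep y k w = `|seq_rep (Xc_repr c) k w|.
  apply: (@stable_seq R y (fun k w => `|seq_rep (Xc_repr c) k w|)) => n.
  by apply: filterS2 (step_rep_map (fun u : X =>
    `|u|) (Xc_repr c n)) (seq_repE n cc.1) => w -> ->.
apply: (L0_limE (r := y)) => //.
apply: filterS2 (seq_lim_cvg cc) yE => w cw yw; rewrite (funext yw).
exact: cvg_norm.
Qed.

End completion_operations.

(** * The isometric isomorphism *)

Section isometry.
Variable X : completeNormedModType R.

(** Both sides are realized by the same strongly measurable functions, so [phi] is the identity on
    realizations and each clause compares two functions almost everywhere. *)
Lemma completion_isometry :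
  cond_isometrically_isomorphic (bochner mu X) (completion mu X).
Proof.
have /choice[phi phiE] : forall x : L0X mu X, exists c : Xc mu X,
    \forall w \ae mu, Xc_lim c w = x w.
  move=> x; have [y [cy yx]] := cauchy_seq_exists (L0X_measurable x).
  by exists (Xc_of y); apply: filterS2 (Xc_ofE cy) yx => w -> ->.
exists phi; split.
- exists (fun c => L0X_of mu (Xc_lim c)) => [x|c].
    apply/L0X_eqP; apply: filterS2 (L0X_of_aeE (Xc_lim_measurable (phi x)))
      (phiE x).
    by move=> w -> ->.
  apply/Xc_eqP; apply: filterS2 (L0X_of_aeE (Xc_lim_measurable c))
    (phiE (L0X_of mu (Xc_lim c))).
  by move=> w <- ->.
- exact: (stable_pointwise (Phi := fun _ u =>
    u) (@L0X_realized X) (@Xc_realized X)).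
- move=> x y; apply/Xc_eqP; apply: filter_app (phiE (L0X_add x y)).
  apply: filter_app (Xc_addE (phi x) (phi y)).
  apply: filterS3 (phiE x) (phiE y) (L0X_addE x y) => w px py xy s1 s2.
  by rewrite /= s2 s1 px py xy.
- move=> r x; apply/Xc_eqP; apply: filter_app (phiE (L0X_scale r x)).
  apply: filterS3 (Xc_scaleE r (phi x)) (phiE x) (L0X_scaleE r x) =>
    w s px rx s2.
  by rewrite /= s2 s px rx.
- move=> x; apply/L0_eqP.
  apply: filterS3 (Xc_normE (phi x)) (phiE x) (L0X_normE x) => w s px nx.
  by rewrite /= s px nx.
Qed.

End isometry.

End theorem.

Theorem theorem4p1 (d : measure_display) (T : measurableType d) (R : realType)
    (mu : {measure set T -> \bar R})
    (mu_complete : measure_is_complete mu)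
    (mu_sigma_finite : sigma_finite setT mu)
    (mu_gt0 : (0 < mu setT)%E)
    (X Y : completeNormedModType R)
    (B : {bilinear X -> Y -> R | *%R & *%R})
    (B_dual_pair : separating B)
    (B_le : forall (x : X) (y : Y), `|B x y| <= `|x| * `|y|)
    (ballX_closed : closed ([set x : X | `|x| <= 1] : set (sigmaXY B)))
    (ballY_closed : closed ([set y : Y | `|y| <= 1] : set (sigmaYX B))) :
  is_cond_banach (bochner mu X) /\
  cond_isometrically_isomorphic (bochner mu X) (completion mu X).
Proof.
split; first exact: bochner_banach.
exact: completion_isometry.
Qed.
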